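(* Let $n\ge 1$ be an integer. Suppose that $f$ is a function on the real line such that the function $x\mapsto f(|x|)$ is in $L^1(\mathbf{R}^{n+2})$ and the function $x\mapsto f(|x|)$ is also in $L^1(\mathbf{R}^n)$. Then \[ \mathcal F_{n+2}(f)(r) = - \frac{1}{2\pi}\, \frac{1}{r}\, \frac{d}{dr}\, \mathcal F_{n}(f)(r) \qquad \text{for all } r>0 . \] Moreover, for every even Schwartz function $\varphi$ on the real line, \[ \mathcal F_{n+2}(\varphi)(r) = \frac{1}{2\pi}\,\frac{1}{r^2}\, \mathcal F_{n}\Big(s^{-n+1}\, \frac{d}{ds}\big(\varphi(s)s^n\big)\Big)(r) \qquad \text{for all } r>0 . \]
   Context: For $\Phi\in L^1(\mathbf{R}^m)$ the Fourier transform is $F_m(\Phi)(\xi)=\int_{\mathbf{R}^m}\Phi(x)\,e^{-2\pi i x\cdot\xi}\,dx$. If $\Phi$ is radial, i.e. $\Phi(x)=\varphi(|x|)$, then $F_m(\Phi)$ is also radial, and $\mathcal F_m(\varphi)$ denotes its radial profile: $\mathcal F_m(\varphi)(r)=F_m(\Phi)(\xi)$ for $r=|\xi|$. In the second formula, $\mathcal F_n$ is applied to the function of $s$ given by $s^{-n+1}\frac{d}{ds}(\varphi(s)s^n)=n\varphi(s)+s\varphi'(s)$, which is an even Schwartz function. *)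

(* Defs.v *)
From HB Require Import structures.
From mathcomp Require Import all_boot all_order all_algebra.
From mathcomp Require Import complex.
From mathcomp Require Import all_classical all_reals all_analysis.

Set Implicit Arguments.
Unset Strict Implicit.
Unset Printing Implicit Defensive.

Import Order.TTheory GRing.Theory Num.Theory.
Import numFieldNormedType.Exports.

Local Open Scope classical_set_scope.
Local Open Scope ring_scope.
Local Open Scope complex_scope.

(* R^m, whose canonical sigma-algebra is the product of the Borel ones. *)
Notation Rn R m := (m.-tuple (measurableTypeR R)).

Definition cons_pair (R : realType) (m : nat)
    (p : Rn R m * measurableTypeR R) : Rn R m.+1 :=
  [the m.+1.-tuple _ of p.2 :: p.1].

Lemma measurable_cons_pair (R : realType) (m : nat) :
  measurable_fun [set: Rn R m * measurableTypeR R] (@cons_pair R m).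
Proof. exact: measurable_cons. Qed.

Definition lebesgue_cons (R : realType) (m : nat)
    (mu : {measure set (Rn R m) -> \bar R}) : set (Rn R m.+1) -> \bar R :=
  pushforward (mu \x @lebesgue_measure R)%E (@cons_pair R m).

(* [pushforward] is a canonical measure only relative to a measurability proof,
   which has to be supplied by hand. *)
HB.instance Definition _ (R : realType) (m : nat)
    (mu : {measure set (Rn R m) -> \bar R}) :=
  Measure.copy (lebesgue_cons mu)
    (@measure_function_pushforward__canonical__measure_function_Measure
       _ _ _ _ _ (mu \x @lebesgue_measure R)%E _ (@measurable_cons_pair R m)).

(* Lebesgue measure on R^m is the m-fold product of the one-dimensional one;
   R^0 is a point of mass 1. *)
Fixpoint lebesgue_tuple (R : realType) (m : nat) :
    {measure set (Rn R m) -> \bar R} :=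
  if m is k.+1 then lebesgue_cons (lebesgue_tuple R k) else \d_[tuple].

Definition dot (R : realType) (m : nat) (x y : Rn R m) : R :=
  \sum_(i < m) tnth x i * tnth y i.

Definition enorm (R : realType) (m : nat) (x : Rn R m) : R :=
  Num.sqrt (dot x x).

Definition radial (R : realType) (m : nat) (f : R -> R[i]) (x : Rn R m) : R[i] :=
  f (enorm x).

(* Being in L^1 means being Lebesgue measurable, i.e. almost everywhere equal to
   a Borel function, and absolutely integrable. *)
Definition L1 (R : realType) (m : nat) (Phi : Rn R m -> R[i]) : Prop :=
  exists Psi : Rn R m -> R[i],
    [/\ (lebesgue_tuple R m).-integrable setT (EFin \o (@complex.Re R \o Psi)),
        (lebesgue_tuple R m).-integrable setT (EFin \o (@complex.Im R \o Psi)) &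
        {ae lebesgue_tuple R m, forall x, Phi x = Psi x}].
Arguments L1 {R} m Phi.

(* The library integral of a nonnegative function is a supremum over the
   measurable simple functions below it, so its value does not change when the
   function is modified on a negligible set: it is the Lebesgue integral also
   for those functions in [L1] that are not Borel. *)
Definition Cintegral (R : realType) (m : nat) (Phi : Rn R m -> R[i]) : R[i] :=
  (\int[lebesgue_tuple R m]_x complex.Re (Phi x)) +i*
  (\int[lebesgue_tuple R m]_x complex.Im (Phi x)).

Definition Cexpi (R : realType) (t : R) : R[i] := cos t +i* sin t.

Definition fourier (R : realType) (m : nat) (Phi : Rn R m -> R[i])
    (xi : Rn R m) : R[i] :=
  Cintegral (fun x => Phi x * Cexpi (- (2 * pi * dot x xi))).

Definition axis_point (R : realType) (m : nat) (r : R) : Rn R m :=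
  [tuple if i == 0%N :> nat then r else 0 | i < m].

(* The Fourier transform of a radial function is radial, so for m >= 1 its
   profile at r >= 0 can be read off at the point (r, 0, ..., 0) of norm r. *)
Definition radial_fourier (R : realType) (m : nat) (f : R -> R[i]) (r : R) :
    R[i] :=
  fourier (@radial R m f) (axis_point m r).

Definition Cderivable (R : realType) (g : R -> R[i]) (x : R) : Prop :=
  derivable (@complex.Re R \o g) x 1 /\ derivable (@complex.Im R \o g) x 1.

Definition Cderive (R : realType) (g : R -> R[i]) (x : R) : R[i] :=
  derive1 (@complex.Re R \o g) x +i* derive1 (@complex.Im R \o g) x.

Definition real_schwartz (R : realType) (g : R -> R) : Prop :=
  (forall (j : nat) (x : R), derivable (derive1n j g) x 1) /\
  (forall k j : nat, exists C : R,
     forall x : R, `|x ^+ k * derive1n j g x| <= C).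

Definition schwartz (R : realType) (g : R -> R[i]) : Prop :=
  real_schwartz (@complex.Re R \o g) /\ real_schwartz (@complex.Im R \o g).

(* s^(1-n) d/ds (phi(s) s^n), for n >= 1.  At s = 0 the convention 0^-1 = 0
   gives 0 instead of the limit n phi(0) when n >= 2; in R^n this concerns the
   origin only, hence no integral. *)
Definition euler_op (R : realType) (n : nat) (phi : R -> R[i]) (s : R) : R[i] :=
  (s ^- n.-1)%:C * Cderive (fun t => phi t * (t ^+ n)%:C) s.

(* Main.v *)
Require Import Defs.
From HB Require Import structures.
From mathcomp Require Import all_boot all_order all_algebra.
From mathcomp Require Import complex.
From mathcomp Require Import all_classical all_reals all_analysis.
From mathcomp Require Import measurable_realfun.
From mathcomp Require Import ring lra.

(** For [g >= 0], splitting [y = (a, b, c, x')] in R^(n+2) and [x = (t, x')] in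
    R^n and integrating over the plane of [(b, c)] first,
      int k(a^2 + b^2 + c^2 + |x'|^2) g(a) da db dc
        = int k(t^2 + |x'|^2) pi |t| (int_(|a| < |t|) g(a) da) dt
    for every fixed [x'].  Taking [g = 1 + cos(w a)] with [w = 2 pi r], and
    [g = 1], and subtracting, the transform of [f] in dimension n+2 at [r] is
    [1/r int_(R^n) f(|x|) x_1 sin(2 pi r x_1) dx], which is [- 1/(2 pi r)] times
    the derivative in [r] of [int_(R^n) f(|x|) cos(2 pi r x_1) dx].

    The second formula follows from the first by homogeneity:
      int_(R^n) e^(n u) phi(e^u |x|) cos(2 pi r x_1) dx = F_n(phi)(r e^(-u)),
    whose derivative at [u = 0] reads
    [F_n(n phi + s phi')(r) = - r F_n(phi)'(r)]. *)

Set Implicit Arguments.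
Unset Strict Implicit.
Unset Printing Implicit Defensive.

Import Order.TTheory GRing.Theory Num.Theory.
Import numFieldNormedType.Exports.

Local Open Scope classical_set_scope.
Local Open Scope ring_scope.

(** * Integrals of almost everywhere equal functions, and measures with a density *)

Section integral_tools.
Import HBNNSimple.

(** By [L1], [radial f] is only almost everywhere equal to a Borel function, which need not be
    radial, whereas the substitutions used here act on a Borel function of the squared norm. The
    argument is therefore run on a Borel profile [k], the same in both dimensions, with
    [f (enorm x)] equal almost everywhere to [k (dot x x)]. The variable q = |x|^2 keeps the
    substitutions elementary: with the weight |t|, the map t -> c + t^2 carries dt to dq, and the
    area of the plane becomes pi dq. Only three coordinates ever move, so neither spheres nor polar
    coordinates in R^m occur. Differentiating in r requires k(|x|^2) x_1 to be integrable on R^n,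
    which is not assumed. The identity with g = 1 identifies integrability on R^(n+2) with that of
    k(|x|^2) x_1^2 on R^n, and |t| <= 1 + t^2 does the rest. Dilations are parametrised by e^u
    because d/du then sends e^(n u) h(e^u s) to the same expression with n h + s h' in place of h,
    at every u and not only at u = 0. *)

Lemma ge0_ae_le_integral_nomeas d (T : measurableType d) (R : realType)
    (mu : {measure set T -> \bar R}) (f g : T -> \bar R) :
  (forall x, 0 <= f x)%E -> (forall x, 0 <= g x)%E ->
  {ae mu, forall x, f x = g x} ->
  (\int[mu]_x f x <= \int[mu]_x g x)%E.
Proof.
move=> f0 g0 [N [mN N0 fgN]].
rewrite !ge0_integralTE//; apply: ge_ereal_sup => _ [h /= hf <-].
have mNc : measurable (~` N) by exact: measurableC.
have hE x : proj_nnsfun h mNc x = h x * (x \in ~` N)%:R by [].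
(* Setting a simple function [h] below [f] to zero on the null set [N] keeps its integral and puts
   it below [g]. *)
apply: ereal_sup_ubound => /=; exists (proj_nnsfun h mNc).
  move=> x; rewrite hE; have [xN|xN] := boolP (x \in ~` N).
    rewrite mulr1; apply: le_trans (hf x) _.
    by rewrite (contra_notP (@fgN x) (set_mem xN)).
  by rewrite mulr0.
rewrite -[LHS]integralT_nnsfun -[RHS]integralT_nnsfun.
apply: ge0_ae_eq_integral => //.
all: try by [exact/measurable_EFinP/measurable_funP|move=> x _; rewrite lee_fin].
exists N; split => // x /= /not_implyP[_]; apply: contra_notP => xN.
by have := hE x; rewrite mem_set// mulr1 => e; exact: congr1.
Qed.

(* No measurability is required of [f] and [g]: the integral of a nonnegative
   function is a supremum over the simple functions below it. *)
Lemma ae_eq_integral_nomeas d (T : measurableType d) (R : realType)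
    (mu : {measure set T -> \bar R}) (f g : T -> \bar R) :
  {ae mu, forall x, f x = g x} -> (\int[mu]_x f x = \int[mu]_x g x)%E.
Proof.
have ge0 (u v : T -> \bar R) : (forall x, 0 <= u x)%E -> (forall x, 0 <= v x)%E ->
    {ae mu, forall x, u x = v x} -> (\int[mu]_x u x = \int[mu]_x v x)%E.
  move=> u0 v0 uv; apply/eqP; rewrite eq_le !ge0_ae_le_integral_nomeas//.
  by apply: filterS uv => x ->.
move=> fg; rewrite integralE [RHS]integralE; congr (_ - _)%E; apply: ge0 => //.
  by apply: filterS fg => x fgx; rewrite !funeposE fgx.
by apply: filterS fg => x fgx; rewrite !funenegE fgx.
Qed.

Section density.
Local Open Scope ereal_scope.
Context d (T : measurableType d) (R : realType) (mu : {measure set T -> \bar R}).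
Variables (w : T -> R) (mw : measurable_fun setT w) (w0 : forall x, (0 <= w x)%R).

(** The two proofs are arguments so that the measure structure declared below can be inferred from
    the term [density mw w0] itself. *)
Definition density of measurable_fun setT w & (forall x, (0 <= w x)%R) :=
  fun A : set T => \int[mu]_(x in A) (w x)%:E.

Local Notation nu := (density mw w0).

Let nu0 : nu set0 = 0. Proof. exact: integral_set0. Qed.

Let nu_ge0 A : 0 <= nu A.
Proof. by apply: integral_ge0 => x _; rewrite lee_fin. Qed.

Let nu_sigma_additive : semi_sigma_additive nu.
Proof.
move=> /= F mF tF mUF; apply: cvg_toP.
  apply: ereal_nondecreasing_is_cvgn => m n mn.
  by apply: lee_sum_nneg_natr => // k _ _; exact: nu_ge0.
rewrite /density ge0_integral_bigcup//.
- by apply: measurable_funTS; exact/measurable_EFinP.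
- by move=> x _; rewrite lee_fin.
Qed.

HB.instance Definition _ := isMeasure.Build _ _ _ nu nu0 nu_ge0 nu_sigma_additive.

Lemma ge0_integral_density (f : T -> \bar R) : measurable_fun setT f ->
  (forall x, 0 <= f x) -> \int[nu]_x f x = \int[mu]_x (f x * (w x)%:E).
Proof.
move=> mf f0; pose f_ := nnsfun_approx measurableT mf.
have cvgf x : (f_ n x)%:E @[n --> \oo] --> f x by exact: cvg_nnsfun_approx.
have mwE : measurable_fun setT (EFin \o w) by exact/measurable_EFinP.
transitivity (limn (fun n => \int[nu]_x (f_ n x)%:E)).
  rewrite -monotone_convergence//.
  - by apply: eq_integral => x _; apply/esym/cvg_lim.
  - by move=> n; exact/measurable_EFinP.
  - by move=> n x _; rewrite lee_fin.
  - by move=> x _ m n mn; rewrite lee_fin; exact/lefP/nd_nnsfun_approx.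
transitivity (limn (fun n => \int[mu]_x ((f_ n x)%:E * (w x)%:E))); last first.
  rewrite -monotone_convergence//.
  - apply: eq_integral => x _; apply/cvg_lim => //.
    exact: cvgeMr.
  - by move=> n; apply: emeasurable_funM => //; exact/measurable_EFinP.
  - by move=> n x _; rewrite mule_ge0// lee_fin.
  - move=> x _ m n mn; rewrite lee_wpmul2r// lee_fin//.
    exact/lefP/nd_nnsfun_approx.
congr (limn _); apply/funext => n; rewrite integralT_nnsfun sintegralE.
(* For a simple function both sides are finite sums over its values [k]: the [nu]-mass of a level
   set is by definition the [mu]-integral of [w] over it. *)
transitivity (\sum_(k \in range (f_ n))
    \int[mu]_x (k%:E * (w x * \1_(f_ n @^-1` [set k]) x)%:E)).
  apply: eq_fsbigr => r /set_mem[y _ <-]; rewrite ge0_integralZl//.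
  - congr (_ * _); rewrite -[LHS]/(\int[mu]_(x in f_ n @^-1` [set f_ n y]) (w x)%:E).
    by rewrite integral_mkcond epatch_indic; apply: eq_integral => x _; rewrite EFinM.
  - by apply/measurable_EFinP; apply: measurable_funM.
  - by move=> x _; rewrite lee_fin mulr_ge0.
  - by rewrite lee_fin.
rewrite -ge0_integral_fsum//.
- apply: eq_integral => x _; rewrite fimfunE -fsumEFin// ge0_mule_fsuml.
    by apply: eq_fsbigr => r _; rewrite -!EFinM; congr EFin; ring.
  move=> r; rewrite lee_fin; exact: nnfun_muleindic_ge0.
- move=> r; apply/measurable_EFinP; apply: measurable_funM => //.
  exact: measurable_funM.
- move=> r x _; rewrite EFinM muleCA mule_ge0 ?lee_fin//.
  exact: nnfun_muleindic_ge0.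
Qed.

End density.

End integral_tools.

(** * Changes of variables on the line, the plane and the space *)

(** Only a distribution function has to be computed in order to change variables: the open left rays
    are stable under intersection, generate the Borel sets and exhaust the line, and [h] has finite
    mass on each, so the image under [phi] of [w] times [mu] must be [h] times Lebesgue measure. *)
Lemma ge0_integral_image_rays d (X : measurableType d) (R : realType)
    (mu : {measure set X -> \bar R}) (phi : X -> measurableTypeR R) (w : X -> R)
    (h : measurableTypeR R -> R) :
  measurable_fun setT phi -> measurable_fun setT w -> (forall x, 0 <= w x) ->
  measurable_fun setT h -> (forall q, 0 <= h q) ->
  (forall a, \int[mu]_(x in phi @^-1` `]-oo, a[) (w x)%:E =
             \int[lebesgue_measure]_(q in `]-oo, a[) (h q)%:E)%E ->
  (forall a, \int[lebesgue_measure]_(q in `]-oo, a[) (h q)%:E < +oo)%E ->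
  forall k : R -> \bar R, measurable_fun setT k -> (forall q, 0 <= k q)%E ->
  (\int[mu]_x (k (phi x) * (w x)%:E) =
   \int[lebesgue_measure]_q (k q * (h q)%:E))%E.
Proof.
move=> mphi mw w0 mh h0 eqrays finrays k mk k0.
pose m2 : {measure set (measurableTypeR R) -> \bar R} :=
  density lebesgue_measure mh h0.
pose m0 : {measure set X -> \bar R} := density mu mw w0.
pose m1 : {measure set (measurableTypeR R) -> \bar R} :=
  @measure_function_pushforward__canonical__measure_function_Measure
       _ _ _ _ _ m0 _ mphi.
have m12 A : measurable A -> m1 A = m2 A.
  apply: (@measure_unique _ R (measurableTypeR R) (@RGenInftyO.G R)
    (fun n => `]-oo, (n%:R : R)[%classic) _ _ _ _ m1 m2).
  - exact: RGenInftyO.measurableE.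
  - move=> _ _ [x ->] [y ->]; exists (Order.min x y).
    apply/seteqP; split=> z /=; rewrite !in_itv/= lt_min.
      by move=> [-> ->].
    by move=> /andP[].
  - by move=> n; exists n%:R.
  - apply/seteqP; split=> // x _; exists (Num.truncn x).+1 => //=.
    by rewrite in_itv/= truncnS_gt.
  - by move=> _ [a ->]; exact: eqrays.
  - by move=> n; rewrite [X in (X < _)%E](eqrays n%:R).
rewrite -(@ge0_integral_density _ _ _ lebesgue_measure _ mh h0 k)//.
rewrite -[RHS](@eq_measure_integral _ _ _ _ m2 m1)//.
  rewrite (@ge0_integral_pushforward _ _ _ _ _ phi mphi m0)//.
  by rewrite -(@ge0_integral_density _ _ _ mu _ mw w0)//; exact: measurableT_comp.
by move=> A mA _; rewrite m12.
Qed.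

Lemma integral_is_derive (R : realType) (f F : R -> R) (a b : R) :
  a <= b -> continuous f -> (forall x : R, is_derive x 1 F (f x)) ->
  (\int[lebesgue_measure]_(x in `[a, b]) (f x)%:E = (F b - F a)%:E)%E.
Proof.
rewrite le_eqVlt => /predU1P[<-|ab] cf dF.
  by rewrite set_itv1 integral_set1 subrr.
have cF : continuous F.
  by move=> x; apply/differentiable_continuous/derivable1_diffP/ex_derive.
rewrite (@continuous_FTC2 _ f F)//.
- exact: continuous_subspaceT.
- split.
  + by move=> x _; exact: ex_derive.
  + by apply: cvg_at_right_filter; exact: cF.
  + by apply: cvg_at_left_filter; exact: cF.
- by move=> x _; rewrite derive1E; exact: derive_val.
Qed.

Lemma preimage_Dsqr_itvNyo (R : realType) (c a : R) : c < a ->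
  (fun t : R => c + t ^+ 2) @^-1` `]-oo, a[ =
  `](- Num.sqrt (a - c)), Num.sqrt (a - c)[%classic.
Proof.
move=> ca; apply/seteqP; split => t /=; rewrite !in_itv/= -ltr_norml.
  rewrite addrC -ltrBrDr => h.
  by rewrite -sqrtr_sqr ltr_sqrt// (le_lt_trans _ h)// sqr_ge0.
by move=> h; rewrite addrC -ltrBrDr -(@ltr_sqrt _ _ (a - c)) ?subr_gt0// sqrtr_sqr.
Qed.

(** With [r = Num.sqrt (a - c)] this is the weighted length of the set where [c + t ^+ 2 < a]. The
    result [a - c] is the length of []c, a[]. *)
Lemma integral_norm_itv (R : realType) (r : R) : 0 <= r ->
  (\int[lebesgue_measure]_(t in `](- r)%R, r[) `|t|%:E = (r ^+ 2)%:E)%E.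
Proof.
move=> r0.
have mn (A : set R) : measurable_fun A (fun t : R => `|t|%:E).
  by apply/measurable_EFinP; exact: measurable_funTS.
rewrite integral_itv_bndo_bndc// integral_itv_obnd_cbnd//.
rewrite (@itv_bndbnd_setU _ _ _ (BRight 0)) ?bnd_simp ?oppr_le0//.
rewrite ge0_integral_setU//=; last 2 first.
- exact: mn.
- by apply/disj_setPS => x [/=]; rewrite !in_itv/= => /andP[_ h1] /andP[h2 _]; lra.
rewrite (@integral_itv_obnd_cbnd R 0)//.
have -> : (\int[lebesgue_measure]_(x in `[(- r)%R, 0%R]) `|x|%:E =
    \int[lebesgue_measure]_(x in `[(- r)%R, 0%R]) (- x)%:E)%E.
  apply: eq_integral => x; rewrite inE/= in_itv/= => /andP[_ h].
  by rewrite ler0_norm.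
have -> : (\int[lebesgue_measure]_(x in `[0%R, r]) `|x|%:E =
    \int[lebesgue_measure]_(x in `[0%R, r]) x%:E)%E.
  apply: eq_integral => x; rewrite inE/= in_itv/= => /andP[h _].
  by rewrite ger0_norm.
have d1 (x : R) : is_derive x 1 (fun t : R => - (t ^+ 2 / 2)) (- x).
  by apply: is_derive_eq; rewrite /GRing.scale/=; field.
have d2 (x : R) : is_derive x 1 (fun t : R => t ^+ 2 / 2) x.
  by apply: is_derive_eq; rewrite /GRing.scale/=; field.
rewrite (integral_is_derive _ _ d1) ?oppr_le0//; last exact: opp_continuous.
rewrite (integral_is_derive _ _ d2)//; last by move=> x; exact: cvg_id.
by rewrite -EFinD; congr EFin; field.
Qed.

(** Above each [q > c] lie two points [t] and [- t], and each contributes [|t|] divided by the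
    derivative [2 * |t|]; hence the density 1 on the right. *)
Lemma integral_sqr_substitution (R : realType) (c : R) (k : R -> \bar R) :
  measurable_fun setT k -> (forall q, 0 <= k q)%E ->
  (\int[lebesgue_measure]_t (k (c + t ^+ 2)%R * `|t|%:E) =
   \int[lebesgue_measure]_q (k q * (\1_(`]c, +oo[%classic) q)%:E))%E.
Proof.
have rays a : (\int[lebesgue_measure]_(q in `]-oo, a[)
    (\1_(`]c, +oo[%classic : set R) q)%:E = (Num.max 0 (a - c))%:E :> \bar R)%E.
  have cE : `]c, +oo[ `&` `]-oo, a[ = `]c, a[%classic :> set R.
    by apply/seteqP; split => x /=; rewrite !in_itv/= andbT => /andP.
  rewrite integral_indic// cE.
  rewrite -[LHS]/(lebesgue_measure `]c, a[%classic) lebesgue_measure_itv/= lte_fin.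
  case: ltP => ca; first by rewrite -EFinB max_r// subr_ge0 ltW.
  by rewrite max_l// subr_le0.
apply: (@ge0_integral_image_rays _ _ _ lebesgue_measure (fun t => c + t ^+ 2)).
- by apply: measurable_funD => //; exact: measurable_funX.
- exact: normr_measurable.
- by [].
- exact: measurable_indic.
- by [].
- move=> a; rewrite rays; have [ca|ac] := ltP c a.
    rewrite preimage_Dsqr_itvNyo// integral_norm_itv ?sqrtr_ge0//.
    have h : 0 <= a - c by rewrite subr_ge0 ltW.
    by rewrite sqr_sqrtr// max_r.
  rewrite (_ : _ @^-1` _ = set0) ?integral_set0 ?max_l ?subr_le0//.
  apply/seteqP; split => t //=; rewrite in_itv/= => h.
  by have := sqr_ge0 t; lra.
- by move=> a; rewrite rays ltry.
Qed.

Lemma ge0_integral_scale (R : realType) (a : R) (k : R -> \bar R) : a != 0 ->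
  measurable_fun setT k -> (forall q, 0 <= k q)%E ->
  (\int[lebesgue_measure]_t (k (a * t)%R * `|a|%:E) =
   \int[lebesgue_measure]_t k t)%E.
Proof.
move=> a0 mk k0.
have ma : measurable_fun setT (fun t : measurableTypeR R => a * t : measurableTypeR R).
  exact: mulrl_measurable.
pose m1 : {measure set (measurableTypeR R) -> \bar R} :=
  @measure_function_pushforward__canonical__measure_function_Measure
       _ _ _ _ _ (@lebesgue_measure R) _ ma.
pose m2 : {measure set (measurableTypeR R) -> \bar R} :=
  mscale (NngNum (normr_ge0 a)) m1.
have m12 A : measurable A -> lebesgue_measure A = m2 A.
  apply: lebesgue_measure_unique => _ [[x y] _ <-].
  rewrite -[RHS]/(`|a|%:E * lebesgue_measure ( *%R a @^-1` `]x, y]))%E.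
  rewrite lebesgue_measure_itv/= lte_fin.
  have [a_gt0|a_le0] := ltP 0 a.
    have -> : *%R a @^-1` `]x, y] = `](x / a), (y / a)]%classic.
      apply/seteqP; split => t /=; rewrite !in_itv/=;
        by rewrite ltr_pdivrMr// ler_pdivlMr// mulrC.
    rewrite lebesgue_measure_itv/= lte_fin ltr_pM2r ?invr_gt0//.
    case: ifP => _; last by rewrite mule0.
    by rewrite gtr0_norm// -!EFinB -EFinM; congr EFin; field.
  have a_lt0 : a < 0 by rewrite lt_neqAle a0.
  (* For negative [a] the preimage of a half-open interval is closed at its other end, which does
     not affect its length. *)
  have -> : *%R a @^-1` `]x, y] = `[(y / a), (x / a)[%classic.
    apply/seteqP; split => t /=; rewrite !in_itv/=;
      by rewrite ltr_ndivlMr// ler_ndivrMr// mulrC andbC.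
  rewrite lebesgue_measure_itv/= lte_fin ltr_nM2r ?invr_lt0//.
  case: ifP => _; last by rewrite mule0.
  by rewrite ltr0_norm// -!EFinB -EFinM; congr EFin; field.
rewrite [RHS](@eq_measure_integral _ _ _ _ m2 lebesgue_measure); last first.
  by move=> A mA _; exact: m12.
rewrite ge0_integral_mscale//=.
rewrite (@ge0_integral_pushforward _ _ _ _ _ _ ma lebesgue_measure)//.
rewrite preimage_setT muleC ge0_integralZr//.
exact: measurableT_comp.
Qed.

Lemma integral_oneDsqrV (R : realType) :
  (\int[lebesgue_measure]_x ((1 + x ^+ 2)^-1)%:E = (pi : R)%:E)%E.
Proof.
rewrite (@ge0_symfun_integralT R (fun x => (1 + x ^+ 2)^-1)).
- have := integral0y_oneDsqr R.
  by rewrite set_itvcy => ->; rewrite -EFinM; congr EFin; field.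
- by move=> x; rewrite invr_ge0 addr_ge0 ?sqr_ge0.
- exact: continuous_oneDsqrV.
- by move=> x; rewrite /= sqrrN.
Qed.

(* The substitution [y = x * s] replaces polar coordinates: integrating first
   in [x], each [s] contributes [(1 + s ^+ 2)^-1] times the right-hand integral. *)
Lemma integral_plane_radial (R : realType) (c : R) (k : R -> \bar R) :
  measurable_fun setT k -> (forall q, 0 <= k q)%E ->
  (\int[lebesgue_measure]_x \int[lebesgue_measure]_y k (c + x ^+ 2 + y ^+ 2)%R =
   pi%:E * \int[lebesgue_measure]_q (k q * (\1_(`]c, +oo[%classic) q)%:E))%E.
Proof.
move=> mk k0; pose lam : {sigma_finite_measure set (measurableTypeR R) -> \bar R} :=
  @lebesgue_measure R.
have msq (e f : R) : measurable_fun setT (fun t : R => e + (f * t) ^+ 2).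
  by apply: measurable_funD => //; apply: measurable_funX; exact: mulrl_measurable.
transitivity (\int[lam]_x \int[lam]_s (k (c + x ^+ 2 + (x * s) ^+ 2)%R * `|x|%:E))%E.
  (* The substitution [y = x * s] breaks down only at [x = 0], a null set. *)
  apply: ae_eq_integral_nomeas; exists [set 0]; split => //.
    exact: lebesgue_measure_set1.
  move=> x /=; apply: contra_notP => /eqP x0.
  rewrite -(ge0_integral_scale x0 (k := fun y => k (c + x ^+ 2 + y ^+ 2)))//.
  apply: measurableT_comp => //.
  by have := msq (c + x ^+ 2) 1; under eq_fun do rewrite mul1r.
rewrite (@fubini_tonelli _ _ _ _ _ lam lam
  (fun p => k (c + p.1 ^+ 2 + (p.1 * p.2) ^+ 2)%R * `|p.1|%:E)%E)/=; last 2 first.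
- apply: emeasurable_funM.
    apply: measurableT_comp => //; apply: measurable_funD.
      by apply: measurable_funD => //; exact: measurable_funX.
    by apply: measurable_funX; exact: measurable_funM.
  by apply/measurable_EFinP; apply: measurableT_comp => //; exact: normr_measurable.
- by move=> p; rewrite mule_ge0// lee_fin.
set I := (X in (pi%:E * X)%E).
have I0 : (0 <= I)%E by apply: integral_ge0 => q _; rewrite mule_ge0// lee_fin.
transitivity (\int[lam]_s (((1 + s ^+ 2)^-1)%:E * I))%E; last first.
  rewrite ge0_integralZr//.
  - by rewrite integral_oneDsqrV.
  - apply/measurable_EFinP; apply: continuous_measurable_fun.
    exact: continuous_oneDsqrV.
  - by move=> x _; rewrite lee_fin invr_ge0 addr_ge0 ?sqr_ge0.
apply: eq_integral => s _.
rewrite /I -integral_sqr_substitution//.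
have s0 : 0 < 1 + s ^+ 2 by rewrite ltr_pwDl// sqr_ge0.
(* Since [x ^+ 2 + (x * s) ^+ 2 = (u * x) ^+ 2], taking [u * x] as the variable divides both the
   weight [|x|] and the length element by [u], whence the factor [(1 + s ^+ 2)^-1]. *)
set u := Num.sqrt (1 + s ^+ 2).
have u0 : 0 < u by rewrite sqrtr_gt0.
have u2 : u ^+ 2 = 1 + s ^+ 2 by rewrite sqr_sqrtr// ltW.
rewrite -(ge0_integral_scale (lt0r_neq0 u0)); last 2 first.
- apply: emeasurable_funM.
    apply: measurableT_comp => //.
    by have := msq c 1; under eq_fun do rewrite mul1r.
  by apply/measurable_EFinP; exact: normr_measurable.
- by move=> q; rewrite mule_ge0// lee_fin.
rewrite -ge0_integralZl//.
- apply: eq_integral => x _.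
  rewrite (gtr0_norm u0) normrM (gtr0_norm u0) -muleA -EFinM muleCA -EFinM.
  congr (k _ * _)%E; first by rewrite !exprMn u2; ring.
  by congr EFin; rewrite -u2; field; rewrite gt_eqF.
- apply: emeasurable_funM; last by [].
  apply: emeasurable_funM; first exact: (measurableT_comp mk (msq c u)).
  apply/measurable_EFinP; apply: measurableT_comp; first exact: normr_measurable.
  exact: mulrl_measurable.
- by move=> x _; rewrite !mule_ge0// lee_fin.
- by rewrite lee_fin invr_ge0 ltW.
Qed.

(** For fixed [a], the plane of [(u, v)] yields [pi] times an integral over [q > a ^+ 2 + c].
    Writing [q = c + t ^+ 2] turns this range into [|a| < |t|], and exchanging [a] with [t] isolates
    the integral of [g]. *)
Lemma integral_space_radial (R : realType) (c : R) (k : R -> \bar R) (g : R -> R) :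
  measurable_fun setT k -> (forall q, 0 <= k q)%E ->
  measurable_fun setT g -> (forall q, 0 <= g q) ->
  (\int[lebesgue_measure]_u \int[lebesgue_measure]_v \int[lebesgue_measure]_a
     (k (a ^+ 2 + (v ^+ 2 + (u ^+ 2 + c)))%R * (g a)%:E) =
   \int[lebesgue_measure]_t (k (t ^+ 2 + c)%R * ((pi * `|t|)%:E *
     \int[lebesgue_measure]_(a in `](- `|t|)%R, `|t|%R[) (g a)%:E)))%E.
Proof.
move=> mk k0 mg g0.
pose lam : {sigma_finite_measure set (measurableTypeR R) -> \bar R} :=
  @lebesgue_measure R.
have mgE : measurable_fun setT (EFin \o g) by exact/measurable_EFinP.
pose G (p : R * R * R) : \bar R :=
  (k (p.1.2 ^+ 2 + (p.2 ^+ 2 + (p.1.1 ^+ 2 + c)))%R * (g p.1.2)%:E)%E.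
have G0 p : (0 <= G p)%E by rewrite mule_ge0// lee_fin.
have mp112 : measurable_fun [set: R * R * R] (fun p => p.1.2).
  exact: (measurableT_comp measurable_snd measurable_fst).
have mp111 : measurable_fun [set: R * R * R] (fun p => p.1.1).
  exact: (measurableT_comp measurable_fst measurable_fst).
have mG : measurable_fun setT G.
  apply: emeasurable_funM; last exact: (measurableT_comp mgE mp112).
  apply: (measurableT_comp mk); apply: measurable_funD; first exact: measurable_funX.
  apply: measurable_funD; first exact: measurable_funX.
  by apply: measurable_funD => //; exact: measurable_funX.
transitivity (\int[lam]_u \int[lam]_a \int[lam]_v G (u, a, v))%E.
  apply: eq_integral => u _.
  rewrite (@fubini_tonelli _ _ _ _ _ lam lam (fun p => G (u, p.2, p.1)))//.
  have mperm : measurable_fun setT (fun p : R * R => (u, p.2, p.1)).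
    by apply: measurable_fun_pair => //; apply: measurable_fun_pair.
  exact: (measurableT_comp mG mperm).
rewrite (@fubini_tonelli _ _ _ _ _ lam lam (fun p => \int[lam]_v G (p, v))%E)/=; last 2 first.
- exact: (measurable_fun_fubini_tonelli_F (m2 := lam) G mG G0).
- by move=> p; exact: integral_ge0.
pose S := [set p : R * R | `|p.1| < `|p.2|].
have mS : measurable S.
  have -> : S = (fun p : R * R => `|p.1| < `|p.2|) @^-1` [set true] by [].
  rewrite -[X in measurable X]setTI; apply: measurable_fun_ltr => //;
    by apply: measurableT_comp => //; exact: normr_measurable.
pose H (p : R * R) : \bar R := (k (p.2 ^+ 2 + c)%R * ((pi * `|p.2|)%:E *
  (\1_S p * g p.1)%:E))%E.
transitivity (\int[lam]_a \int[lam]_t H (a, t))%E.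
  apply: eq_integral => a _.
  pose k1 (s : R) := (k s * (g a)%:E)%E.
  have mk1 : measurable_fun setT k1 by apply: emeasurable_funM.
  have k10 s : (0 <= k1 s)%E by rewrite mule_ge0// lee_fin.
  pose k2 (s : R) := (pi%:E * (k1 s * (\1_(`](a ^+ 2 + c)%R, +oo[%classic) s)%:E))%E.
  have mk2' : measurable_fun setT
      (fun s => k1 s * (\1_(`](a ^+ 2 + c)%R, +oo[%classic) s)%:E)%E.
    apply: emeasurable_funM => //.
    by apply/measurable_EFinP; exact: measurable_indic.
  have mk2 : measurable_fun setT k2 by apply: measurable_funeM.
  transitivity (\int[lam]_x \int[lam]_y k1 (a ^+ 2 + c + x ^+ 2 + y ^+ 2)%R)%E.
    apply: eq_integral => u _; apply: eq_integral => v _.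
    by rewrite /G /k1/=; congr (k _ * _)%E; ring.
  rewrite integral_plane_radial// -ge0_integralZl//; last 2 first.
  - by move=> s _; rewrite mule_ge0// lee_fin.
  - by rewrite lee_fin pi_ge0.
  (* The condition [s > c] is implied by [s > a ^+ 2 + c]; inserting it gives the shape in which
     [integral_sqr_substitution] can be read from right to left. *)
  transitivity (\int[lam]_s (k2 s * (\1_(`]c, +oo[%classic) s)%:E))%E.
    apply: eq_integral => s _; rewrite /k2 -[RHS]muleA; congr (_ * _)%E.
    rewrite -[RHS]muleA; congr (k1 s * _)%E.
    rewrite -EFinM !indicE; congr EFin; rewrite -natrM mulnb; congr (_%:R); congr nat_of_bool.
    apply/idP/andP => [|[]//] h; split => //; apply/mem_set.
    have := set_mem h; rewrite /= !in_itv/= !andbT => h'.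
    by have := sqr_ge0 a; lra.
  rewrite -integral_sqr_substitution//; last first.
    by move=> s; rewrite !mule_ge0// lee_fin ?pi_ge0.
  apply: eq_integral => t _; rewrite /H /k2 /k1/= addrC.
  have lt_sqr : (`|a| < `|t|) = (a ^+ 2 + c < t ^+ 2 + c).
    rewrite ltrD2r -[a ^+ 2]real_normK ?num_real// -[t ^+ 2]real_normK ?num_real//.
    by rewrite ltr_pXn2r ?nnegrE.
  have -> : \1_(`](a ^+ 2 + c), +oo[%classic) (t ^+ 2 + c) = \1_S (a, t) :> R.
    rewrite !indicE; congr (_%:R); congr nat_of_bool; apply/idP/idP => h;
      apply/mem_set; have := set_mem h; by rewrite /S/= in_itv/= andbT lt_sqr.
  rewrite -!muleA muleCA; congr (_ * _)%E.
  by rewrite -!EFinM; congr EFin; ring.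
have H0 p : (0 <= H p)%E.
  by rewrite !mule_ge0// lee_fin mulr_ge0// pi_ge0.
have mH : measurable_fun setT H.
  apply: emeasurable_funM.
    apply: (measurableT_comp mk); apply: measurable_funD => //.
    exact: measurable_funX.
  apply: emeasurable_funM; apply/measurable_EFinP.
    apply: measurable_funM => //.
    by apply: measurableT_comp => //; exact: normr_measurable.
  apply: measurable_funM; first exact: measurable_indic.
  exact: (measurableT_comp mg measurable_fst).
rewrite (@fubini_tonelli _ _ _ _ _ lam lam H mH H0).
apply: eq_integral => t _; rewrite /H/=.
have mSt : measurable_fun setT (fun a : R => (\1_S (a, t) * g a)%:E).
  apply/measurable_EFinP; apply: measurable_funM => //.
  have mpt : measurable_fun setT (fun a : R => (a, t)) by exact: measurable_fun_pair.
  exact: (measurableT_comp (measurable_indic mS) mpt).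
have St0 (a : R) : (0 <= (\1_S (a, t) * g a)%:E)%E by rewrite lee_fin mulr_ge0.
have pit0 : (0 <= (pi * `|t|)%:E)%E by rewrite lee_fin mulr_ge0 ?pi_ge0.
rewrite ge0_integralZl//; last 2 first.
- by apply: measurable_funeM.
- by move=> a _; exact: mule_ge0.
rewrite ge0_integralZl//; congr (_ * (_ * _))%E.
rewrite [RHS]integral_mkcond epatch_indic; apply: eq_integral => a _.
rewrite /= -EFinM mulrC; congr EFin; congr (_ * _).
rewrite !indicE; congr (_%:R); congr nat_of_bool; apply/idP/idP => h;
  by apply/mem_set; have := set_mem h; rewrite /S/= in_itv/= -ltr_norml.
Qed.

(** * Integration over R^m by slices *)

(* Fubini's theorem needs a sigma-finite structure, which cannot be declared on
   the term [lebesgue_tuple R m] itself since it is already a bundled measure. *)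
Section sigma_finite_copy.
Context d (T : measurableType d) (R : realType) (mu : {measure set T -> \bar R}).
Hypothesis fin_mu : sigma_finite setT mu.

Definition sf_copy of sigma_finite setT mu := fun A => mu A.

HB.instance Definition _ := Measure.copy (sf_copy fin_mu) mu.
HB.instance Definition _ :=
  Measure_isSigmaFinite.Build _ _ _ (sf_copy fin_mu) fin_mu.

End sigma_finite_copy.

Definition uncons_pair (R : realType) (m : nat) (x : Rn R m.+1) :
    Rn R m * measurableTypeR R :=
  ([tuple of behead x], tnth x ord0).

Lemma cons_pairK (R : realType) (m : nat) :
  cancel (@cons_pair R m) (@uncons_pair R m).
Proof.
case=> x t; rewrite /uncons_pair/=; congr (_, _).
  exact/val_inj.
Qed.

Lemma measurable_uncons_pair (R : realType) (m : nat) :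
  measurable_fun setT (@uncons_pair R m).
Proof.
apply: measurable_fun_pair; first exact: measurable_behead.
exact: measurable_tnth.
Qed.

Lemma sigma_finite_lebesgue_tuple (R : realType) (m : nat) :
  sigma_finite setT (lebesgue_tuple R m).
Proof.
elim: m => [|m IHm].
  exists (fun=> setT); first by rewrite bigcup_const.
  move=> _; split => //.
  by rewrite [X in (X < _)%E]diracT ltry.
pose s : {sigma_finite_measure set (Rn R m) -> \bar R} := sf_copy IHm.
have /sigma_finiteP[F [TF ndF Ffin]] := sigma_finiteT s.
have /sigma_finiteP[G [TG ndG Gfin]] := sigma_finiteT (@lebesgue_measure R).
exists (fun k => @uncons_pair R m @^-1` (F k `*` G k)).
  rewrite -preimage_bigcup -[LHS](preimage_setT (@uncons_pair R m)); congr preimage.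
  rewrite -setXTT TF TG; apply/seteqP; split=> [[x y]/= [[n _ Fnx] [k _ Gky]]|[x y] [n _ [? ?]]].
    exists (maxn n k) => //; split.
    - by move: x Fnx; exact/subsetPset/ndF/leq_maxl.
    - by move: y Gky; exact/subsetPset/ndG/leq_maxr.
  by split; exists n.
move=> k; have [mF Fk] := Ffin k; have [mG Gk] := Gfin k; split.
  rewrite -[X in measurable X]setTI; apply: measurable_uncons_pair => //.
  exact: measurableX.
rewrite [X in (X < _)%E](_ : _ = (s \x @lebesgue_measure R)%E (F k `*` G k)).
  by rewrite product_measure1E// lte_mul_pinfty// ge0_fin_numE.
rewrite -[LHS]/((s \x @lebesgue_measure R)%E
  (@cons_pair R m @^-1` (@uncons_pair R m @^-1` (F k `*` G k)))).
congr (product_measure1 _ _ _); apply/funext => p.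
by rewrite -[LHS]/((F k `*` G k) (uncons_pair (cons_pair p))) cons_pairK.
Qed.

Lemma ge0_integral_lebesgue_tupleS (R : realType) (m : nat)
    (F : Rn R m.+1 -> \bar R) :
  measurable_fun setT F -> (forall x, 0 <= F x)%E ->
  (\int[lebesgue_tuple R m.+1]_x F x =
   \int[lebesgue_tuple R m]_x \int[lebesgue_measure]_t F (cons_pair (x, t)))%E.
Proof.
move=> mF F0.
pose s : {sigma_finite_measure set (Rn R m) -> \bar R} :=
  sf_copy (sigma_finite_lebesgue_tuple R m).
rewrite [LHS](@ge0_integral_pushforward _ _ _ _ _ _
  (@measurable_cons_pair R m) (s \x @lebesgue_measure R)%E)//.
rewrite preimage_setT (@fubini_tonelli1 _ _ _ _ _ s lebesgue_measure)//=.
exact: (measurableT_comp mF (@measurable_cons_pair R m)).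
Qed.

Lemma measurable_integral_cons (R : realType) (m : nat) (F : Rn R m.+1 -> \bar R) :
  measurable_fun setT F -> (forall x, 0 <= F x)%E ->
  measurable_fun setT
    (fun x : Rn R m => \int[lebesgue_measure]_t F (cons_pair (x, t)))%E.
Proof.
move=> mF F0; apply: (@measurable_fun_fubini_tonelli_F _ _ _ _ _ lebesgue_measure
  (fun p => F (cons_pair p))).
  exact: (measurableT_comp mF (@measurable_cons_pair R m)).
by move=> p; exact: F0.
Qed.

Section coordinates.
Context {R : realType}.

Lemma dot_cons_pair (m : nat) (p q : Rn R m * measurableTypeR R) :
  dot (cons_pair p) (cons_pair q) = p.2 * q.2 + dot p.1 q.1.
Proof.
rewrite /dot big_ord_recl !(tnth_nth 0)/=; congr (_ + _).
by apply: eq_bigr => i _; rewrite !(tnth_nth 0).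
Qed.

Lemma tnth_cons_pair0 (m : nat) (p : Rn R m * measurableTypeR R) :
  tnth (cons_pair p) ord0 = p.2.
Proof. by rewrite (tnth_nth 0). Qed.

Lemma dot_ge0 (m : nat) (x : Rn R m) : 0 <= dot x x.
Proof. by apply: sumr_ge0 => i _; rewrite -expr2 sqr_ge0. Qed.

Lemma sqr_enorm (m : nat) (x : Rn R m) : enorm x ^+ 2 = dot x x.
Proof. by rewrite sqr_sqrtr// dot_ge0. Qed.

Lemma dot_axis_point (m : nat) (x : Rn R m.+1) (r : R) :
  dot x (axis_point m.+1 r) = tnth x ord0 * r.
Proof.
rewrite /dot (bigD1 ord0)//= tnth_mktuple/= big1 ?addr0// => i i0.
by rewrite tnth_mktuple ifN ?mulr0.
Qed.

Lemma measurable_dot (m : nat) : measurable_fun setT (fun x : Rn R m => dot x x).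
Proof.
apply: measurable_sum => i.
by apply: measurable_funM; exact: measurable_tnth.
Qed.

Lemma measurable_coord0 (m : nat) (g : R -> R) : measurable_fun setT g ->
  measurable_fun setT (fun x : Rn R m.+1 => g (tnth x ord0)).
Proof. by move=> mg; exact: (measurableT_comp mg (measurable_tnth ord0)). Qed.

(** [cons_pair] adds a coordinate in front, so peeling three coordinates off R^(m+3) makes the first
    one, on which [g] depends, the innermost variable. Peeling one off R^(m+1) leaves the same
    remaining point of R^m, and the identity holds for each such point by
    [integral_space_radial]. *)
Lemma integral_lebesgue_tuple_radial (m : nat) (k : R -> \bar R) (g K : R -> R) :
  measurable_fun setT k -> (forall q, 0 <= k q)%E ->
  measurable_fun setT g -> (forall q, 0 <= g q) -> measurable_fun setT K ->
  (forall t, \int[lebesgue_measure]_(a in `](- `|t|)%R, `|t|%R[) (g a)%:E =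
     (K t)%:E)%E ->
  (\int[lebesgue_tuple R m.+3]_y (k (dot y y) * (g (tnth y ord0))%:E) =
   \int[lebesgue_tuple R m.+1]_x
     (k (dot x x) * (pi * `|tnth x ord0| * K (tnth x ord0))%:E))%E.
Proof.
move=> mk k0 mg g0 mK gK.
have K0 t : 0 <= K t.
  by rewrite -lee_fin -gK; apply: integral_ge0 => a _; rewrite lee_fin.
pose F (y : Rn R m.+3) := (k (dot y y) * (g (tnth y ord0))%:E)%E.
have F0 y : (0 <= F y)%E by rewrite mule_ge0// lee_fin.
have mF : measurable_fun setT F.
  apply: emeasurable_funM; first exact: (measurableT_comp mk (@measurable_dot _)).
  by apply/measurable_EFinP; exact: measurable_coord0.
rewrite (ge0_integral_lebesgue_tupleS mF F0).
have mF2 := measurable_integral_cons mF F0.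
have F20 (x : Rn R m.+2) :
    (0 <= \int[lebesgue_measure]_t F (cons_pair (x, t)))%E.
  by apply: integral_ge0 => t _.
rewrite (ge0_integral_lebesgue_tupleS mF2 F20).
have mF3 := measurable_integral_cons mF2 F20.
rewrite (ge0_integral_lebesgue_tupleS mF3); last first.
  by move=> x; apply: integral_ge0 => t _.
rewrite ge0_integral_lebesgue_tupleS; last 2 first.
- apply: emeasurable_funM; first exact: (measurableT_comp mk (@measurable_dot _)).
  apply/measurable_EFinP; apply: (@measurable_coord0 _ (fun t => pi * `|t| * K t)).
  apply: measurable_funM => //; apply: measurable_funM => //; exact: normr_measurable.
- by move=> x; rewrite mule_ge0// lee_fin !mulr_ge0// pi_ge0.
apply: eq_integral => x _.
transitivity (\int[lebesgue_measure]_u \int[lebesgue_measure]_v \int[lebesgue_measure]_a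
     (k (a ^+ 2 + (v ^+ 2 + (u ^+ 2 + dot x x)))%R * (g a)%:E))%E.
  apply: eq_integral => u _; apply: eq_integral => v _; apply: eq_integral => a _.
  by rewrite /F tnth_cons_pair0 !dot_cons_pair/= !expr2.
rewrite integral_space_radial//; apply: eq_integral => t _.
by rewrite gK tnth_cons_pair0 dot_cons_pair/= -EFinM expr2.
Qed.

End coordinates.

Lemma integral_oneDcos (R : realType) (w t : R) : w != 0 ->
  (\int[lebesgue_measure]_(a in `](- `|t|)%R, `|t|%R[) (1 + cos (w * a))%:E =
   (2 * (`|t| + sin (w * `|t|) / w))%:E)%E.
Proof.
move=> w0.
have cf : continuous (fun a : R => 1 + cos (w * a)).
  move=> a; apply: cvgD; first exact: cvg_cst.
  apply: continuous_comp; last exact: continuous_cos.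
  exact: mulrl_continuous.
have mf (A : set R) : measurable_fun A (fun a => (1 + cos (w * a))%:E).
  by apply/measurable_EFinP; apply: measurable_funTS; exact: continuous_measurable_fun.
have df (x : R) : is_derive x 1 (fun a : R => a + sin (w * a) / w) (1 + cos (w * x)).
  by apply: is_derive_eq; rewrite /GRing.scale/=; field.
rewrite integral_itv_bndo_bndc// integral_itv_obnd_cbnd//.
rewrite (integral_is_derive _ _ df)//; last by rewrite lerNl (le_trans _ (normr_ge0 t))// oppr_le0.
by rewrite mulrN sinN; congr EFin; field.
Qed.

(** * From dimension m.+3 to dimension m.+1 *)

Section dimension_shift.
Context {R : realType} (m : nat).
Local Notation mu3 := (lebesgue_tuple R m.+3).
Local Notation mu1 := (lebesgue_tuple R m.+1).

Lemma integral_lebesgue_tuple_radial1 (k : R -> R) :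
  measurable_fun setT k -> (forall q, 0 <= k q) ->
  (\int[mu3]_y (k (dot y y))%:E =
   \int[mu1]_x (k (dot x x) * (2 * pi * tnth x ord0 ^+ 2))%:E)%E.
Proof.
move=> mk k0.
have := @integral_lebesgue_tuple_radial R m (EFin \o k) (fun=> 1) (fun t => 2 * `|t|).
rewrite /=; under eq_integral do rewrite mule1.
move=> ->//.
- apply: eq_integral => x _; rewrite -EFinM; congr (_ * _)%:E.
  by rewrite -[tnth x ord0 ^+ 2]real_normK ?num_real//; ring.
- exact/measurable_EFinP.
- by apply: measurable_funM => //; exact: normr_measurable.
- move=> t; rewrite integral_cst//= mul1e lebesgue_measure_itv/= lte_fin.
  case: ltP => [_|]; first by rewrite -EFinB; congr EFin; ring.
  by have := normr_ge0 t => ? ?; congr EFin; lra.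
Qed.

(* [1 + cos] rather than [cos], so that Tonelli's theorem applies. *)
Lemma integral_lebesgue_tuple_radial_oneDcos (w : R) (k : R -> R) : w != 0 ->
  measurable_fun setT k -> (forall q, 0 <= k q) ->
  (\int[mu3]_y (k (dot y y) * (1 + cos (w * tnth y ord0)))%:E =
   \int[mu1]_x (k (dot x x) * (2 * pi * tnth x ord0 ^+ 2 +
     2 * pi / w * (tnth x ord0 * sin (w * tnth x ord0))))%:E)%E.
Proof.
move=> w0 mk k0.
have mw (f : R -> R) : continuous f -> measurable_fun setT (fun t => f (w * t)).
  move=> cf; apply: continuous_measurable_fun => t.
  by apply: continuous_comp; [exact: mulrl_continuous|exact: cf].
have := @integral_lebesgue_tuple_radial R m (EFin \o k)
  (fun a => 1 + cos (w * a)) (fun t => 2 * (`|t| + sin (w * `|t|) / w)).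
move=> /= ->//.
- apply: eq_integral => x _; rewrite -EFinM; congr (_ * _)%:E.
  set t := tnth x ord0.
  have -> : t * sin (w * t) = `|t| * sin (w * `|t|).
    have [t0|t0] := leP 0 t; first by rewrite ger0_norm.
    by rewrite ltr0_norm// !mulrN sinN mulrNN.
  by rewrite -[t ^+ 2]real_normK ?num_real//; field.
- exact/measurable_EFinP.
- by apply: measurable_funD => //; apply: mw; exact: continuous_cos.
- apply: measurable_funM => //; apply: measurable_funD; first exact: normr_measurable.
  apply: measurable_funM => //.
  apply: (measurableT_comp (mw _ (@continuous_sin R))); exact: normr_measurable.
- by move=> t; exact: integral_oneDcos.
Qed.

Lemma measurable_radial_mul (n : nat) (k g : R -> R) :
  measurable_fun setT k -> measurable_fun setT g ->
  measurable_fun setT (fun x : Rn R n.+1 => k (dot x x) * g (tnth x ord0)).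
Proof.
move=> mk mg; apply: measurable_funM; first exact: (measurableT_comp mk (@measurable_dot _ _)).
exact: measurable_coord0.
Qed.

Lemma le_integrable_EFin d (T : measurableType d) (mu : {measure set T -> \bar R})
    (f g : T -> R) : measurable_fun setT f -> (forall x, `|f x| <= `|g x|) ->
  mu.-integrable setT (EFin \o g) -> mu.-integrable setT (EFin \o f).
Proof.
move=> mf fg; apply: le_integrable => //; first exact/measurable_EFinP.
by move=> x _; rewrite lee_fin.
Qed.

(** By [integral_lebesgue_tuple_radial1] applied to [|k|], the second moment in the first coordinate
    is, up to the factor [2 * pi], the integral of [|k|] two dimensions higher. *)
Lemma integrable_radial_sqr (k : R -> R) : measurable_fun setT k ->
  mu3.-integrable setT (EFin \o (fun y => k (dot y y))) ->
  mu1.-integrable setT (EFin \o (fun x => k (dot x x) * tnth x ord0 ^+ 2)).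
Proof.
move=> mk /integrableP[mk3 ik3].
have mnk : measurable_fun setT (fun q => `|k q|).
  by apply: measurableT_comp => //; exact: normr_measurable.
have mkx : measurable_fun setT
    (fun x : Rn R m.+1 => k (dot x x) * (2 * pi * tnth x ord0 ^+ 2)).
  apply: (@measurable_radial_mul m k (fun t => 2 * pi * t ^+ 2)) => //.
  by apply: measurable_funM => //; exact: measurable_funX.
have : mu1.-integrable setT
    (EFin \o (fun x => k (dot x x) * (2 * pi * tnth x ord0 ^+ 2))).
  apply/integrableP; split; first exact/measurable_EFinP.
  have := integral_lebesgue_tuple_radial1 mnk (fun q => normr_ge0 (k q)).
  rewrite /= in ik3 => e; rewrite e in ik3.
  apply: le_lt_trans ik3; rewrite le_eqVlt; apply/orP; left; apply/eqP.
  apply: eq_integral => x _ /=.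
  have h : 0 <= 2 * pi * tnth x ord0 ^+ 2.
    by rewrite mulr_ge0 ?sqr_ge0// mulr_ge0// pi_ge0.
  by rewrite normrM (ger0_norm h).
apply: le_integrable_EFin.
  by apply: (@measurable_radial_mul m k (fun t => t ^+ 2)) => //; exact: measurable_funX.
move=> x; rewrite !normrM ler_wpM2l// ler_peMl//.
have := pi_ge2 R; rewrite ger0_norm// ?pi_ge0// => h.
by rewrite ger0_norm// ; lra.
Qed.

(** The first moment lies between the other two, as [|t| <= 1 + t ^+ 2]. This provides the majorant
    for differentiating [cos_transform]. *)
Lemma integrable_radial_coord0 (k : R -> R) : measurable_fun setT k ->
  mu3.-integrable setT (EFin \o (fun y => k (dot y y))) ->
  mu1.-integrable setT (EFin \o (fun x => k (dot x x))) ->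
  mu1.-integrable setT (EFin \o (fun x => k (dot x x) * tnth x ord0)).
Proof.
move=> mk i3 i1.
have i2 := integrable_radial_sqr mk i3.
have : mu1.-integrable setT
    (EFin \o (fun x => `|k (dot x x)| + `|k (dot x x) * tnth x ord0 ^+ 2|)).
  exact: (integrableD measurableT (integrable_norm i1) (integrable_norm i2)).
apply: le_integrable_EFin; first exact: (@measurable_radial_mul m k id).
move=> x; rewrite [leRHS]ger0_norm ?addr_ge0// !normrM.
set t := `|tnth x ord0|; set u := `|k _|.
have u0 : 0 <= u by exact: normr_ge0.
have -> : u + u * (t * t) = u * (1 + t ^+ 2) by ring.
by apply: ler_wpM2l => //; have := sqr_ge0 (t - 1); have := sqr_ge0 t; rewrite sqrrB; lra.
Qed.

Lemma integrable_mul_bounded (n : nat) (f g : Rn R n -> R) :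
  measurable_fun setT g -> (forall x, `|g x| <= 1) ->
  (lebesgue_tuple R n).-integrable setT (EFin \o f) ->
  (lebesgue_tuple R n).-integrable setT (EFin \o (fun x => f x * g x)).
Proof.
move=> mg g1 /[dup] /integrableP[/measurable_EFinP mf _].
apply: le_integrable_EFin; first exact: measurable_funM.
by move=> x; rewrite normrM ler_piMr.
Qed.

Lemma measurable_cos_coord0 (n : nat) (w : R) :
  measurable_fun setT (fun x : Rn R n.+1 => cos (w * tnth x ord0)).
Proof.
apply: (@measurable_coord0 R n (fun t => cos (w * t))).
apply: continuous_measurable_fun => t.
by apply: continuous_comp; [exact: mulrl_continuous|exact: continuous_cos].
Qed.

Lemma measurable_sin_coord0 (n : nat) (w : R) :
  measurable_fun setT (fun x : Rn R n.+1 => sin (w * tnth x ord0)).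
Proof.
apply: (@measurable_coord0 R n (fun t => sin (w * t))).
apply: continuous_measurable_fun => t.
by apply: continuous_comp; [exact: mulrl_continuous|exact: continuous_sin].
Qed.

Lemma Rintegral_dimension_shift_ge0 (w : R) (k : R -> R) : w != 0 ->
  measurable_fun setT k -> (forall q, 0 <= k q) ->
  mu3.-integrable setT (EFin \o (fun y => k (dot y y))) ->
  mu1.-integrable setT (EFin \o (fun x => k (dot x x))) ->
  \int[mu3]_y (k (dot y y) * cos (w * tnth y ord0)) =
  2 * pi / w * \int[mu1]_x (k (dot x x) * tnth x ord0 * sin (w * tnth x ord0)).
Proof.
move=> w0 mk k0 i3 i1.
have i3c := integrable_mul_bounded (@measurable_cos_coord0 _ w)
  (fun x => cos_max _) i3.
have ix := integrable_radial_coord0 mk i3 i1.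
have ixs := integrable_mul_bounded (@measurable_sin_coord0 _ w)
  (fun x => sin_max _) ix.
have ixx := integrable_radial_sqr mk i3.
have E1 := congr1 fine (integral_lebesgue_tuple_radial1 mk k0).
have E2 := congr1 fine (integral_lebesgue_tuple_radial_oneDcos w0 mk k0).
have : \int[mu3]_y (k (dot y y) + k (dot y y) * cos (w * tnth y ord0)) =
  \int[mu1]_x (2 * pi * (k (dot x x) * tnth x ord0 ^+ 2) +
    2 * pi / w * (k (dot x x) * tnth x ord0 * sin (w * tnth x ord0))).
  rewrite /Rintegral.
  under eq_integral do rewrite -[X in X + _]mulr1 -mulrDr.
  by rewrite E2; congr fine; apply: eq_integral => x _; congr EFin; field.
rewrite RintegralD// RintegralD//; last 2 first.
- exact: (integrableZl measurableT (2 * pi) ixx).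
- exact: (integrableZl measurableT (2 * pi / w) ixs).
rewrite RintegralZl// RintegralZl// => E.
have {}E1 : \int[mu3]_y k (dot y y) =
    2 * pi * \int[mu1]_x (k (dot x x) * tnth x ord0 ^+ 2).
  rewrite -RintegralZl// [LHS]E1; congr fine; apply: eq_integral => x _.
  by congr EFin; ring.
by apply: (addrI (\int[mu3]_y k (dot y y))); rewrite E {1}E1.
Qed.

(** Both sides are linear in [k], so the nonnegative case is applied to the positive and negative
    parts of [k], which inherit integrability because [|k|] dominates them. *)
Lemma Rintegral_dimension_shift (w : R) (k : R -> R) : w != 0 ->
  measurable_fun setT k ->
  mu3.-integrable setT (EFin \o (fun y => k (dot y y))) ->
  mu1.-integrable setT (EFin \o (fun x => k (dot x x))) ->
  \int[mu3]_y (k (dot y y) * cos (w * tnth y ord0)) =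
  2 * pi / w * \int[mu1]_x (k (dot x x) * tnth x ord0 * sin (w * tnth x ord0)).
Proof.
move=> w0 mk i3 i1.
pose kp q := Num.max (k q) 0; pose kn q := Num.max (- k q) 0.
have kE q : k q = kp q - kn q.
  by rewrite /kp /kn; case: (leP (k q) 0) => h; case: leP => h' ; lra.
have mkp : measurable_fun setT kp by apply: measurable_maxr.
have mkn : measurable_fun setT kn.
  by apply: measurable_maxr => //; exact: measurableT_comp.
have kp0 q : 0 <= kp q by rewrite le_max lexx orbT.
have kn0 q : 0 <= kn q by rewrite le_max lexx orbT.
have lekp q : `|kp q| <= `|k q|.
  by rewrite (ger0_norm (kp0 q)) ge_max normr_ge0 ler_norm.
have lekn q : `|kn q| <= `|k q|.
  by rewrite (ger0_norm (kn0 q)) ge_max normr_ge0 lerNl lerNnormlW.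
have mQ n (h : R -> R) : measurable_fun setT h ->
    measurable_fun setT (fun x : Rn R n => h (dot x x)).
  by move=> mh; exact: (measurableT_comp mh (@measurable_dot _ _)).
have ip n : (lebesgue_tuple R n).-integrable setT (EFin \o (fun y => k (dot y y))) ->
    (lebesgue_tuple R n).-integrable setT (EFin \o (fun y => kp (dot y y))).
  by apply: le_integrable_EFin => //; exact: mQ.
have inn n : (lebesgue_tuple R n).-integrable setT (EFin \o (fun y => k (dot y y))) ->
    (lebesgue_tuple R n).-integrable setT (EFin \o (fun y => kn (dot y y))).
  by apply: le_integrable_EFin => //; exact: mQ.
under eq_Rintegral do rewrite kE mulrBl.
under [in RHS]eq_Rintegral do rewrite kE !mulrBl.
have icos h : mu3.-integrable setT (EFin \o (fun y => h (dot y y))) ->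
    mu3.-integrable setT (EFin \o (fun y => h (dot y y) * cos (w * tnth y ord0))).
  apply: integrable_mul_bounded; first exact: measurable_cos_coord0.
  by move=> x; exact: cos_max.
have isin h : measurable_fun setT h ->
    mu3.-integrable setT (EFin \o (fun y => h (dot y y))) ->
    mu1.-integrable setT (EFin \o (fun y => h (dot y y))) ->
    mu1.-integrable setT
      (EFin \o (fun x => h (dot x x) * tnth x ord0 * sin (w * tnth x ord0))).
  move=> mh h3 h1; apply: (integrable_mul_bounded (@measurable_sin_coord0 _ w)).
    by move=> x; exact: sin_max.
  exact: integrable_radial_coord0.
rewrite RintegralB//; [|exact/icos/ip|exact/icos/inn].
rewrite RintegralB//; [|by apply: isin => //; exact: ip|by apply: isin => //; exact: inn].
rewrite mulrBr -!Rintegral_dimension_shift_ge0//; first [exact: ip|exact: inn].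
Qed.

End dimension_shift.

(** For a radial function the sine part of the Fourier integral vanishes and this is what remains at
    the point [(r, 0, ..., 0)]. The profile [k] is a function of the squared norm, the variable in
    which the substitutions act. The integral is over R^(m+1), so raising the dimension by two turns
    [m] into [m.+2]. *)
Definition cos_transform (R : realType) (m : nat) (k : R -> R) (r : R) : R :=
  \int[lebesgue_tuple R m.+1]_x (k (dot x x) * cos (2 * pi * r * tnth x ord0)).

Lemma is_derive_cos_transform (R : realType) (m : nat) (k : R -> R) (r : R) :
  measurable_fun setT k ->
  (lebesgue_tuple R m.+1).-integrable setT (EFin \o (fun x => k (dot x x))) ->
  (lebesgue_tuple R m.+1).-integrable setT
    (EFin \o (fun x => k (dot x x) * tnth x ord0)) ->
  is_derive r 1 (cos_transform m k) (- (2 * pi) * \int[lebesgue_tuple R m.+1]_x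
    (k (dot x x) * tnth x ord0 * sin (2 * pi * r * tnth x ord0))).
Proof.
move=> mk i1 ix.
pose f (s : R) (x : Rn R m.+1) := k (dot x x) * cos (2 * pi * s * tnth x ord0).
have df (s : R) x : is_derive s 1 (f ^~ x)
    (- (2 * pi) * (k (dot x x) * tnth x ord0 * sin (2 * pi * s * tnth x ord0))).
  by rewrite /f; apply: is_derive_eq; rewrite /GRing.scale/=; ring.
have rI : (`](r - 1), (r + 1)[%classic : set R) r.
  by rewrite /= in_itv/=; apply/andP; split; lra.
have intf s : (`](r - 1), (r + 1)[%classic : set R) s ->
    (lebesgue_tuple R m.+1).-integrable setT (EFin \o f s).
  move=> _; apply: integrable_mul_bounded => //; first exact: measurable_cos_coord0.
  by move=> x; exact: cos_max.
have derf s x : (`](r - 1), (r + 1)[%classic : set R) s -> setT x ->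
    derivable (f ^~ x) s 1 by move=> _ _; exact: ex_derive.
(* The bound on the derivative is uniform in [s] because [|sin| <= 1], so the radius 1 of the
   interval around [r] is arbitrary. *)
pose G (x : Rn R m.+1) := `|2 * pi * (k (dot x x) * tnth x ord0)|.
have intG : (lebesgue_tuple R m.+1).-integrable setT (EFin \o G).
  exact: (integrable_norm (integrableZl measurableT (2 * pi) ix)).
have d1f s x : partial1of2 f s x =
    - (2 * pi) * (k (dot x x) * tnth x ord0 * sin (2 * pi * s * tnth x ord0)).
  by rewrite partial1of2E; exact: derive_val.
have Gub s x : (`](r - 1), (r + 1)[%classic : set R) s -> setT x ->
    `|partial1of2 f s x| <= G x.
  by move=> _ _; rewrite d1f mulNr normrN mulrA normrM /G ler_piMr// sin_max.
have G0 : forall y, 0 <= G y by move=> y; exact: normr_ge0.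
have ex : derivable (cos_transform m k) r 1.
  exact: (derivable_under_integral measurableT rI intf derf G0 intG Gub).
have dv := differentiation_under_integral measurableT rI intf derf G0 intG Gub.
apply: DeriveDef; first exact: ex.
rewrite -derive1E [LHS]dv -RintegralZl//; last first.
  apply: integrable_mul_bounded => //; first exact: measurable_sin_coord0.
  by move=> x; exact: sin_max.
by apply: eq_Rintegral => x _; exact: d1f.
Qed.

(** The same integral of [k (dot x x)] times [t * sin (2 * pi * r * t)], with [t] the first
    coordinate, occurs with factor [r^-1] in the transform two dimensions higher and with factor
    [- (2 * pi)] in the derivative; it is eliminated between the two. *)
Lemma cos_transform_dimension_shift (R : realType) (m : nat) (k : R -> R) (r : R) :
  measurable_fun setT k -> r != 0 ->
  (lebesgue_tuple R m.+3).-integrable setT (EFin \o (fun x => k (dot x x))) ->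
  (lebesgue_tuple R m.+1).-integrable setT (EFin \o (fun x => k (dot x x))) ->
  derivable (cos_transform m k) r 1 /\
  cos_transform m.+2 k r = - ((2 * pi)^-1) * r^-1 * derive1 (cos_transform m k) r.
Proof.
move=> mk r0 i3 i1.
have dT := is_derive_cos_transform r mk i1 (integrable_radial_coord0 mk i3 i1).
have p0 : (pi : R) != 0 by rewrite gt_eqF// pi_gt0.
split; first exact: ex_derive.
rewrite derive1E (@derive_val _ _ _ _ _ _ _ dT) /cos_transform.
rewrite Rintegral_dimension_shift//; last by rewrite !mulf_neq0.
by move: p0; generalize (pi : R) => p p0; field; rewrite r0 p0.
Qed.

(** * Radial functions that are almost everywhere Borel *)

Section slices.
Context {R : realType}.

Definition slice (m : nat) (Z : set (Rn R m.+1)) (x : Rn R m) : set (measurableTypeR R) :=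
  [set t | Z (cons_pair (x, t))].

Lemma measurable_slice (m : nat) (Z : set (Rn R m.+1)) (x : Rn R m) :
  measurable Z -> measurable (slice Z x).
Proof.
move=> mZ; rewrite -[X in measurable X]setTI.
have := measurableT_comp (@measurable_cons_pair R m) (@pair1_measurable _ _ _ _ x).
exact.
Qed.

Lemma lebesgue_tupleS_null (m : nat) (Z : set (Rn R m.+1)) : measurable Z ->
  lebesgue_tuple R m.+1 Z = 0%E <->
  {ae lebesgue_tuple R m, forall x, lebesgue_measure (slice Z x) = 0%E}.
Proof.
move=> mZ; have mZ' : measurable (@cons_pair R m @^-1` Z).
  by rewrite -[X in measurable X]setTI; exact: measurable_cons_pair.
have sE x : xsection (@cons_pair R m @^-1` Z) x = slice Z x.
  by apply/seteqP; split => t; rewrite xsectionE.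
have mf : measurable_fun setT (fun x => lebesgue_measure (slice Z x)).
  have := @measurable_fun_xsection _ _ _ _ R lebesgue_measure _ mZ'.
  by apply: eq_measurable_fun => x _; rewrite /= sE.
have -> : lebesgue_tuple R m.+1 Z =
    (\int[lebesgue_tuple R m]_x `|lebesgue_measure (slice Z x)|)%E.
  apply: eq_integral => x _; rewrite gee0_abs//.
  by rewrite -sE.
rewrite (ae_eq_integral_abs _ measurableT mf); split; apply: filterS => x.
  by move=> h; rewrite h.
by move=> h _; rewrite h.
Qed.

(** A null set contains no ball around the origin. In the induction [e] is shared equally: a point
    [x] with null slice is found with [dot x x < e / 2], and that slice cannot contain the whole
    interval of length [Num.sqrt (e / 2)]. *)
Lemma exists_small_notin (m : nat) (Z : set (Rn R m)) (e : R) : measurable Z ->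
  lebesgue_tuple R m Z = 0%E -> 0 < e -> exists2 x, ~ Z x & dot x x < e.
Proof.
elim: m => [|m IHm] in Z e * => mZ Z0 e0.
  exists [tuple]; last by rewrite /dot big_ord0.
  move=> Zt; move: Z0; rewrite [X in X = _]diracE mem_set//.
  by move=> /eqP; rewrite onee_eq0.
have /(lebesgue_tupleS_null mZ) [N [mN N0 ZN]] := Z0.
have e20 : 0 < e / 2 by rewrite divr_gt0.
have [x Nx xe] := IHm N (e / 2) mN N0 e20.
have sx0 : lebesgue_measure (slice Z x) = 0%E by exact: contra_notP (@ZN x) Nx.
have [t ts Zt] : exists2 t, t \in `]0, (Num.sqrt (e / 2))[ & ~ slice Z x t.
  apply: contrapT => h.
  have sub : `]0, (Num.sqrt (e / 2))[ `<=` slice Z x.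
    by move=> t /= tI; apply: contrapT => Zt; apply: h; exists t.
  have : lebesgue_measure `]0, (Num.sqrt (e / 2))[%classic = 0%E.
    apply: (subset_measure0 (mu := lebesgue_measure)) sub sx0; first exact: measurable_itv.
    exact: measurable_slice.
  move/eqP; rewrite lebesgue_measure_itv/= lte_fin sqrtr_gt0 e20 sube0.
  by rewrite eqe sqrtr_eq0 leNgt e20.
exists (cons_pair (x, t)) => //; rewrite dot_cons_pair/= -expr2.
move: ts; rewrite in_itv/= => /andP[t0 ts].
have : t ^+ 2 < e / 2.
  by rewrite -[ltRHS](sqr_sqrtr (ltW e20)) ltr_pXn2r// nnegrE ?sqrtr_ge0// ltW.
by lra.
Qed.

End slices.

Section radial_profile.
Context {R : realType}.

Lemma measurable_sqrtB (c : R) :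
  measurable_fun setT (fun q : R => Num.sqrt (q - c)).
Proof.
have ms : measurable_fun setT (@Num.sqrt R).
  by apply: continuous_measurable_fun; exact: sqrt_continuous.
have mB : measurable_fun setT (fun q : R => q - c) by exact: measurable_funB.
exact: (measurableT_comp ms mB).
Qed.

Lemma measurable_image_sqr (c : R) (S : set R) : measurable S ->
  measurable [set q | c < q /\ S (Num.sqrt (q - c))].
Proof.
move=> mS.
have -> : [set q | c < q /\ S (Num.sqrt (q - c))] =
    (fun q : R => Num.sqrt (q - c)) @^-1` S `&` `]c, +oo[.
  by apply/seteqP; split => q /=; rewrite in_itv/= andbT => -[].
apply: measurableI => //; rewrite -[X in measurable X]setTI.
exact: measurable_sqrtB.
Qed.

(** This set is the image of the positive part of [S] under [t -> c + t ^+ 2]. Read backwards,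
    [integral_sqr_substitution] turns its measure into the integral of a function of [t] that
    vanishes off the null set formed by [S] and its reflection. *)
Lemma null_image_sqr (c : R) (S : set R) : measurable S ->
  lebesgue_measure S = 0%E ->
  lebesgue_measure [set q | c < q /\ S (Num.sqrt (q - c))] = 0%E.
Proof.
move=> mS S0.
have mf := measurable_sqrtB c.
pose T := (fun q : R => Num.sqrt (q - c)) @^-1` S.
have mT : measurable T by rewrite -[X in measurable X]setTI; exact: mf.
have mI : measurable_fun setT (fun q => (\1_T q)%:E : \bar R).
  by apply/measurable_EFinP; exact: measurable_indic.
have -> : [set q | c < q /\ S (Num.sqrt (q - c))] = T `&` `]c, +oo[.
  by apply/seteqP; split => q /=; rewrite in_itv/= andbT => -[].
transitivity (\int[lebesgue_measure]_q ((\1_T q)%:E * (\1_(`]c, +oo[%classic) q)%:E) : \bar R)%E.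
  transitivity (\int[lebesgue_measure]_q (\1_(T `&` `]c, +oo[%classic) q)%:E : \bar R)%E.
    by rewrite integral_indic ?setIT//; exact: measurableI.
  by apply: eq_integral => q _; rewrite -EFinM indicI.
rewrite -integral_sqr_substitution//.
rewrite (ae_eq_integral_nomeas (g := cst 0%E)) ?integral0//.
have mSN : measurable (-%R @^-1` S).
  by rewrite -[X in measurable X]setTI; exact: oppr_measurable.
exists (S `|` -%R @^-1` S); split; first exact: measurableU.
  have SN0 : lebesgue_measure (-%R @^-1` S) = 0%E.
    exact: etrans (lebesgue_measureN mS) S0.
  apply/eqP; rewrite -measure_le0.
  have := @measureU2 _ _ _ lebesgue_measure _ _ mS mSN.
  by move=> /le_trans; apply; rewrite [X in (X + _)%E]S0 [X in (_ + X)%E]SN0 adde0.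
move=> t /=; apply: contra_notP => /not_orP[St SNt].
rewrite indicE memNset ?mul0e// /T/= addrC addKr sqrtr_sqr.
by case: (leP 0 t) => t0; [rewrite ger0_norm|rewrite ltr0_norm].
Qed.

(* [h] itself need not be Borel.  By Fubini there are [x_ j] in R^m tending to 0
   such that [h (Num.sqrt (t ^+ 2 + dot (x_ j) (x_ j)))] is a.e. in [t] equal to
   the Borel function [Psi (t, x_ j)]; solving for [t] determines [h] a.e. above
   the norm of [x_ j], and [k] is the limit of these determinations. *)
Lemma radial_profile (m : nat) (h : R -> R) (Psi : Rn R m.+1 -> R) :
  measurable_fun setT Psi ->
  {ae lebesgue_tuple R m.+1, forall x, h (enorm x) = Psi x} ->
  exists2 k : R -> R, measurable_fun setT k &
    {ae lebesgue_measure, forall q : R, 0 < q -> h (Num.sqrt q) = k q}.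
Proof.
move=> mPsi [N [mN N0 hN]].
have [N' [mN' N'0 sN']] := (lebesgue_tupleS_null mN).1 N0.
have /choice[x_ hx] (j : nat) : exists x : Rn R m, ~ N' x /\ dot x x < j.+1%:R^-1.
  have j0 : 0 < j.+1%:R^-1 :> R by rewrite invr_gt0.
  by have [x ? ?] := exists_small_notin mN' N'0 j0; exists x.
pose c j := dot (x_ j) (x_ j).
pose k_ j q := Psi (cons_pair (x_ j, Num.sqrt (q - c j))).
have mk_ j : measurable_fun setT (k_ j).
  apply: (measurableT_comp mPsi).
  have := measurableT_comp (@measurable_cons_pair R m) (@pair1_measurable _ _ _ _ (x_ j)).
  move=> /measurableT_comp; apply.
  exact: measurable_sqrtB.
(* The upper limit exists for every [q] and is Borel. Off a null set the sequence is eventually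
   constant, since [k_ j q] equals [h (Num.sqrt q)] once [c j < q]. *)
exists (fun q => fine (limn_esup (fun j => (k_ j q)%:E))).
  apply: (measurableT_comp (fine_measurable measurableT)).
  by apply: measurable_fun_limn_esup => j; exact/measurable_EFinP.
pose B j := [set q | c j < q /\ slice N (x_ j) (Num.sqrt (q - c j))].
have B0 j : lebesgue_measure (B j) = 0%E.
  apply: null_image_sqr; first exact: measurable_slice.
  by apply: contrapT => /sN'; have [] := hx j.
have neg : (@lebesgue_measure R).-negligible (\bigcup_j B j).
  apply: negligible_bigcup => j; apply/negligibleP; last exact: B0.
  by apply: measurable_image_sqr; exact: measurable_slice.
apply: negligibleS neg => q /=; apply: contra_notP => hq q0.
have kE j : c j < q -> k_ j q = h (Num.sqrt q).
  move=> cq; have Nj : ~ N (cons_pair (x_ j, Num.sqrt (q - c j))).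
    by apply: contra_not hq => Nj; exists j.
  rewrite /k_ -(contra_notP (@hN _) Nj) /enorm dot_cons_pair/= -expr2.
  by rewrite sqr_sqrtr ?subr_ge0 ?(ltW cq)// subrK.
suff : (k_ j q)%:E @[j --> \oo] --> (h (Num.sqrt q))%:E.
  by move=> /cvg_limn_einf_sup[_ ->].
apply: cvg_near_cst; near=> j; rewrite kE//.
have [_ /lt_le_trans] := hx j; apply.
rewrite -[leRHS]invrK lef_pV2 ?posrE ?invr_gt0//.
near: j; exists (Num.truncn q^-1) => // j /= tj.
by rewrite (le_trans (ltW (truncnS_gt _)))// ler_nat.
Unshelve. all: by end_near. Qed.

(** The squared norm pulls null sets back to null sets. On each line parallel to the first axis, the
    integral of [\1_N (c + t ^+ 2) * |t|] is the measure of a part of [N], hence zero, so the slice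
    is null apart from [t = 0]. *)
Lemma ae_radial (m : nat) (h k : R -> R) :
  {ae lebesgue_measure, forall q : R, 0 < q -> h (Num.sqrt q) = k q} ->
  {ae lebesgue_tuple R m.+1, forall x, h (enorm x) = k (dot x x)}.
Proof.
move=> [N [mN N0 hk]].
have mI : measurable_fun setT (fun q => (\1_N q)%:E : \bar R).
  by apply/measurable_EFinP; exact: measurable_indic.
(* The hyperplane is added for two reasons: the weight [|t|] gives no information at [t = 0], and
   the origin, where [dot x x] is not positive, has to be discarded. *)
pose Z := [set x : Rn R m.+1 | N (dot x x)] `|` [set x | tnth x ord0 = 0].
have mZ : measurable Z.
  apply: measurableU; rewrite -[X in measurable X]setTI.
    exact: measurable_dot.
  by apply: (measurable_tnth ord0 _ (measurable_set1 0)).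
exists Z; split => //; last first.
  move=> x /=; apply: contra_notP => /not_orP[Nx x0].
  have := contra_notP (@hk (dot x x)) Nx; rewrite /mkset; apply.
  rewrite lt_neqAle dot_ge0 andbT eq_sym; apply/eqP => xx0; apply: x0.
  have : tnth x ord0 * tnth x ord0 <= dot x x.
    by rewrite /dot (bigD1 ord0)//= lerDl; apply: sumr_ge0 => i _; rewrite -expr2 sqr_ge0.
  by rewrite xx0 -expr2 real_exprn_even_le0 ?num_real//= => /eqP.
apply/lebesgue_tupleS_null => //; apply: aeW => x.
pose c := dot x x.
pose G (t : R) : \bar R := ((\1_N (c + t ^+ 2)%R : R)%:E * `|t|%:E)%E.
have : (\int[lebesgue_measure]_t `|G t| = 0)%E.
  transitivity (\int[lebesgue_measure]_t G t)%E.
    by apply: eq_integral => t _; rewrite gee0_abs// mule_ge0// lee_fin.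
  rewrite (@integral_sqr_substitution R c (fun q => (\1_N q)%:E))//.
  rewrite (ae_eq_integral_nomeas (g := cst 0%E)) ?integral0//.
  exists N; split => // q /=; apply: contra_notP => Nq.
  by rewrite indicE memNset// mul0e.
have msq : measurable_fun setT (fun t : R => c + t ^+ 2).
  by apply: measurable_funD => //; exact: measurable_funX.
move=> /(ae_eq_integral_abs lebesgue_measure measurableT) h0.
have {h0} [] := h0.
  apply: emeasurable_funM; first exact: (measurableT_comp mI msq).
  by apply/measurable_EFinP; exact: normr_measurable.
move=> M [mM M0 sM].
have negM0 : (@lebesgue_measure R).-negligible (M `|` [set 0]).
  by apply: negligibleU; apply/negligibleP => //; exact: lebesgue_measure_set1.
apply/(negligibleP _ (measurable_slice x mZ)).
apply: negligibleS negM0 => t /=.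
rewrite /slice/= /Z/= tnth_cons_pair0/= => -[Nt|->]; last by right.
have [->|t0] := eqVneq t 0; [by right|left].
apply: sM => /= /(_ Logic.I) /eqP; rewrite /G.
rewrite dot_cons_pair/= -expr2 addrC in Nt.
by rewrite indicE mem_set// mul1e eqe normr_eq0 (negbTE t0).
Qed.

End radial_profile.

(** * Dilations *)

Section dilation.
Context {R : realType}.

Definition dilate (m : nat) (a : R) (x : Rn R m) : Rn R m :=
  [tuple a * tnth x i | i < m].

Lemma measurable_dilate (m : nat) (a : R) : measurable_fun setT (@dilate m a).
Proof.
apply/measurable_fun_tnthP => i.
have -> : (@tnth m (measurableTypeR R))^~ i \o dilate a = (fun x => a * tnth x i).
  by apply/funext => x; rewrite /= tnth_mktuple.
by apply: measurable_funM => //; exact: measurable_tnth.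
Qed.

Lemma dot_dilate (m : nat) (a : R) (x : Rn R m) :
  dot (dilate a x) (dilate a x) = a ^+ 2 * dot x x.
Proof.
rewrite /dot mulr_sumr; apply: eq_bigr => i _.
by rewrite tnth_mktuple; ring.
Qed.

Lemma dilate_cons_pair (m : nat) (a : R) (x : Rn R m) (t : measurableTypeR R) :
  dilate a (cons_pair (x, t)) = cons_pair (dilate a x, a * t : measurableTypeR R).
Proof.
have tnth_lift (y : Rn R m) (s : measurableTypeR R) j :
    tnth (cons_pair (y, s)) (lift ord0 j) = tnth y j by rewrite !(tnth_nth 0).
apply: eq_from_tnth => i; rewrite tnth_mktuple.
case: (unliftP ord0 i) => [j ->|->]; last by rewrite !tnth_cons_pair0.
by rewrite !tnth_lift tnth_mktuple.
Qed.

Lemma ge0_integral_dilate (m : nat) (a : R) (F : Rn R m -> \bar R) : a != 0 ->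
  measurable_fun setT F -> (forall x, 0 <= F x)%E ->
  (\int[lebesgue_tuple R m]_x (F (dilate a x) * (`|a| ^+ m)%:E) =
   \int[lebesgue_tuple R m]_x F x)%E.
Proof.
move=> a0; elim: m F => [|m IHm] F mF F0.
  by apply: eq_integral => x _; rewrite expr0 mule1 [x]tuple0 [dilate _ _]tuple0.
have am0 n : (0 <= (`|a| ^+ n)%:E)%E by rewrite lee_fin exprn_ge0.
have mFd : measurable_fun setT (fun x => F (dilate a x)).
  exact: (measurableT_comp mF (@measurable_dilate _ a)).
rewrite ge0_integral_lebesgue_tupleS; last 2 first.
- by apply: emeasurable_funM.
- by move=> x; rewrite mule_ge0.
rewrite [RHS]ge0_integral_lebesgue_tupleS// -[RHS]IHm; last 2 first.
- exact: measurable_integral_cons.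
- by move=> x; exact: integral_ge0.
apply: eq_integral => x _.
have mFc (y : Rn R m) : measurable_fun setT (fun t => F (cons_pair (y, t))).
  have := measurableT_comp (@measurable_cons_pair R m) (@pair1_measurable _ _ _ _ y).
  exact: measurableT_comp.
rewrite -(ge0_integral_scale a0 (mFc (dilate a x)))// -ge0_integralZr//; last 2 first.
- apply: emeasurable_funM => //.
  exact: (measurableT_comp (mFc (dilate a x)) (@mulrl_measurable R setT a)).
- by move=> t _; rewrite mule_ge0// lee_fin.
by apply: eq_integral => t _; rewrite dilate_cons_pair -muleA -EFinM exprS.
Qed.

Lemma Rintegral_dilate (m : nat) (a : R) (F : Rn R m -> R) : a != 0 ->
  measurable_fun setT F ->
  \int[lebesgue_tuple R m]_x (F (dilate a x) * `|a| ^+ m) =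
  \int[lebesgue_tuple R m]_x F x.
Proof.
move=> a0 mF; congr fine; have mFE : measurable_fun setT (EFin \o F) by exact/measurable_EFinP.
have am0 : (0 <= (`|a| ^+ m)%:E)%E by rewrite lee_fin exprn_ge0.
rewrite integralE [RHS]integralE.
rewrite -(ge0_integral_dilate a0 (measurable_funepos mFE))//.
rewrite -(ge0_integral_dilate a0 (measurable_funeneg mFE))//.
congr (_ - _)%E; apply: eq_integral => x _.
  under [in LHS]eq_fun do rewrite EFinM muleC.
  by rewrite ge0_funeposM ?exprn_ge0// muleC !funeposE.
under [in LHS]eq_fun do rewrite EFinM muleC.
by rewrite ge0_funenegM ?exprn_ge0// muleC !funenegE.
Qed.

(* Dilation by [-1]. *)
Lemma Rintegral_sin_coord0 (m : nat) (w : R) (k : R -> R) : measurable_fun setT k ->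
  (lebesgue_tuple R m.+1).-integrable setT (EFin \o (fun x => k (dot x x))) ->
  \int[lebesgue_tuple R m.+1]_x (k (dot x x) * sin (w * tnth x ord0)) = 0.
Proof.
move=> mk ik.
have isin := integrable_mul_bounded (@measurable_sin_coord0 R m w)
  (fun x => sin_max _) ik.
have /integrableP[/measurable_EFinP mf _] := isin.
have a0 : -1 != 0 :> R by rewrite oppr_eq0 oner_eq0.
have := Rintegral_dilate a0 mf; rewrite normrN1 expr1n.
under eq_Rintegral do rewrite dot_dilate tnth_mktuple sqrrN expr1n mul1r mulr1
  mulN1r mulrN sinN mulrN -mulN1r.
by rewrite RintegralZl// => h; lra.
Qed.

(** The real and imaginary parts of [f] each meet both the cosine and the sine; the sine integrals
    vanish by the symmetry [x -> - x]. The replacement of [f] by [k1] and [k2] goes through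
    [ae_eq_integral_nomeas], as [f] may fail to be Borel. *)
Lemma radial_fourierE (m : nat) (f : R -> R[i]) (k1 k2 : R -> R) (r : R) :
  measurable_fun setT k1 -> measurable_fun setT k2 ->
  (lebesgue_tuple R m.+1).-integrable setT (EFin \o (fun x => k1 (dot x x))) ->
  (lebesgue_tuple R m.+1).-integrable setT (EFin \o (fun x => k2 (dot x x))) ->
  {ae lebesgue_tuple R m.+1, forall x, complex.Re (f (enorm x)) = k1 (dot x x)} ->
  {ae lebesgue_tuple R m.+1, forall x, complex.Im (f (enorm x)) = k2 (dot x x)} ->
  radial_fourier m.+1 f r = (cos_transform m k1 r +i* cos_transform m k2 r)%C.
Proof.
move=> mk1 mk2 i1 i2 fk1 fk2.
have icos (k : R -> R) :
    (lebesgue_tuple R m.+1).-integrable setT (EFin \o (fun x => k (dot x x))) ->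
    (lebesgue_tuple R m.+1).-integrable setT
      (EFin \o (fun x => k (dot x x) * cos (2 * pi * r * tnth x ord0))).
  apply: integrable_mul_bounded; first exact: measurable_cos_coord0.
  by move=> x; exact: cos_max.
have isin (k : R -> R) :
    (lebesgue_tuple R m.+1).-integrable setT (EFin \o (fun x => k (dot x x))) ->
    (lebesgue_tuple R m.+1).-integrable setT
      (EFin \o (fun x => k (dot x x) * sin (2 * pi * r * tnth x ord0))).
  apply: integrable_mul_bounded; first exact: measurable_sin_coord0.
  by move=> x; exact: sin_max.
have angle (x : Rn R m.+1) : 2 * pi * dot x (axis_point m.+1 r) = 2 * pi * r * tnth x ord0.
  by rewrite dot_axis_point; ring.
rewrite /radial_fourier /fourier /Cintegral /radial /Cexpi; congr (_ +i* _)%C.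
- transitivity (\int[lebesgue_tuple R m.+1]_x
    (k1 (dot x x) * cos (2 * pi * r * tnth x ord0) +
     k2 (dot x x) * sin (2 * pi * r * tnth x ord0))).
    congr fine; apply: ae_eq_integral_nomeas.
    apply: filterS2 fk1 fk2 => x e1 e2; rewrite angle cosN sinN -e1 -e2.
    by case: (f _) => a b /=; congr EFin; ring.
  by rewrite RintegralD ?Rintegral_sin_coord0 ?addr0//; [exact: icos|exact: isin].
- transitivity (\int[lebesgue_tuple R m.+1]_x
    (k2 (dot x x) * cos (2 * pi * r * tnth x ord0) -
     k1 (dot x x) * sin (2 * pi * r * tnth x ord0))).
    congr fine; apply: ae_eq_integral_nomeas.
    apply: filterS2 fk1 fk2 => x e1 e2; rewrite angle cosN sinN -e1 -e2.
    by case: (f _) => a b /=; congr EFin; ring.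
  by rewrite RintegralB ?Rintegral_sin_coord0 ?subr0//; [exact: icos|exact: isin].
Qed.

End dilation.

(** * The first formula for radial functions in [L1] *)

Lemma ae_eq_integrable d (T : measurableType d) (R : realType)
    (mu : {measure set T -> \bar R}) (f g : T -> R) :
  measurable_fun setT g -> {ae mu, forall x, f x = g x} ->
  mu.-integrable setT (EFin \o f) -> mu.-integrable setT (EFin \o g).
Proof.
move=> mg fg /integrableP[_ If]; apply/integrableP; split; first exact/measurable_EFinP.
apply: le_lt_trans If; rewrite le_eqVlt; apply/orP; left; apply/eqP.
by apply: ae_eq_integral_nomeas; apply: filterS fg => x /= ->.
Qed.

Section radial_L1.
Context {R : realType}.

Lemma measurable_comp_dot (m : nat) (k : R -> R) : measurable_fun setT k ->
  measurable_fun setT (fun x : Rn R m => k (dot x x)).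
Proof. by move=> mk; exact: (measurableT_comp mk (@measurable_dot _ _)). Qed.

(** The profiles are extracted from the Borel representative in dimension m+1 alone. They are
    determined for almost every [q > 0], a condition without reference to the dimension, so
    [ae_radial] makes them valid in dimension m+3 too. *)
Lemma radial_L1_profile (m : nat) (f : R -> R[i]) :
  L1 m.+3 (radial f) -> L1 m.+1 (radial f) ->
  exists k1 k2 : R -> R,
    [/\ measurable_fun setT k1, measurable_fun setT k2,
        {ae lebesgue_measure, forall q : R, 0 < q -> complex.Re (f (Num.sqrt q)) = k1 q},
        {ae lebesgue_measure, forall q : R, 0 < q -> complex.Im (f (Num.sqrt q)) = k2 q} &
        forall n, n = m.+1 \/ n = m.+3 ->
        (lebesgue_tuple R n).-integrable setT (EFin \o (fun x => k1 (dot x x))) /\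
        (lebesgue_tuple R n).-integrable setT (EFin \o (fun x => k2 (dot x x)))].
Proof.
move=> [Psi3 [iR3 iI3 fPsi3]] [Psi1 [iR1 iI1 fPsi1]].
have [/measurable_EFinP mR1 _] := (integrableP _ _ _ iR1).
have [/measurable_EFinP mI1 _] := (integrableP _ _ _ iI1).
have [|k1 mk1 fk1] := radial_profile (h := @complex.Re R \o f) mR1.
  by apply: filterS fPsi1 => x /= <-.
have [|k2 mk2 fk2] := radial_profile (h := @complex.Im R \o f) mI1.
  by apply: filterS fPsi1 => x /= <-.
exists k1, k2; split => // n [|] ->; split.
- apply: ae_eq_integrable iR1; first exact: measurable_comp_dot.
  by apply: filterS2 fPsi1 (ae_radial m (h := @complex.Re R \o f) fk1) => x /= <-.
- apply: ae_eq_integrable iI1; first exact: measurable_comp_dot.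
  by apply: filterS2 fPsi1 (ae_radial m (h := @complex.Im R \o f) fk2) => x /= <-.
- apply: ae_eq_integrable iR3; first exact: measurable_comp_dot.
  by apply: filterS2 fPsi3 (ae_radial m.+2 (h := @complex.Re R \o f) fk1) => x /= <-.
- apply: ae_eq_integrable iI3; first exact: measurable_comp_dot.
  by apply: filterS2 fPsi3 (ae_radial m.+2 (h := @complex.Im R \o f) fk2) => x /= <-.
Qed.

Lemma radial_fourier_dimension_shift (m : nat) (f : R -> R[i]) (r : R) :
  L1 m.+3 (radial f) -> L1 m.+1 (radial f) -> 0 < r ->
  Cderivable (radial_fourier m.+1 f) r /\
  radial_fourier m.+3 f r =
    (- ((2 * pi)^-1)%:C * (r^-1)%:C * Cderive (radial_fourier m.+1 f) r)%C.
Proof.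
move=> f3 f1 r0.
have [k1 [k2 [mk1 mk2 fk1 fk2 ik]]] := radial_L1_profile f3 f1.
have [i11 i12] := ik m.+1 (or_introl erefl).
have [i31 i32] := ik m.+3 (or_intror erefl).
have E1 : radial_fourier m.+1 f =
    fun s => (cos_transform m k1 s +i* cos_transform m k2 s)%C.
  apply/funext => s.
  exact: (radial_fourierE s mk1 mk2 i11 i12
    (ae_radial _ (h := @complex.Re R \o f) fk1)
    (ae_radial _ (h := @complex.Im R \o f) fk2)).
have E3 : radial_fourier m.+3 f r = (cos_transform m.+2 k1 r +i* cos_transform m.+2 k2 r)%C.
  exact: (radial_fourierE r mk1 mk2 i31 i32
    (ae_radial _ (h := @complex.Re R \o f) fk1)
    (ae_radial _ (h := @complex.Im R \o f) fk2)).
have [d1 s1] := cos_transform_dimension_shift mk1 (lt0r_neq0 r0) i31 i11.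
have [d2 s2] := cos_transform_dimension_shift mk2 (lt0r_neq0 r0) i32 i12.
split; first by rewrite E1; split; [exact: d1|exact: d2].
rewrite E3 E1 s1 s2 /Cderive.
rewrite -[@complex.Re R \o _]/(cos_transform m k1) -[@complex.Im R \o _]/(cos_transform m k2).
by simpc; congr (_ +i* _)%C; ring.
Qed.

End radial_L1.

(** * Schwartz functions *)

Section cauchy_weight.
Context {R : realType}.

(** A majorant in product form: Tonelli's theorem gives its integral [pi ^+ m] one coordinate at a
    time, where a radial majorant would call for polar coordinates. *)
Definition cauchy_weight (m : nat) (x : Rn R m) : R :=
  \prod_(i < m) (1 + tnth x i ^+ 2)^-1.

Lemma measurable_oneDsqrV : measurable_fun setT (fun t : R => (1 + t ^+ 2)^-1).
Proof. by apply: continuous_measurable_fun; exact: continuous_oneDsqrV. Qed.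

Lemma oneDsqr_gt0 (t : R) : 0 < 1 + t ^+ 2.
Proof. by rewrite ltr_pwDl// sqr_ge0. Qed.

Lemma cauchy_weight_ge0 (m : nat) (x : Rn R m) : 0 <= cauchy_weight x.
Proof. by apply: prodr_ge0 => i _; rewrite invr_ge0 ltW// oneDsqr_gt0. Qed.

Lemma measurable_cauchy_weight (m : nat) : measurable_fun setT (@cauchy_weight m).
Proof.
apply: measurable_prod => i _.
exact: (measurableT_comp measurable_oneDsqrV (measurable_tnth i)).
Qed.

Lemma cauchy_weight_cons_pair (m : nat) (p : Rn R m * measurableTypeR R) :
  cauchy_weight (cons_pair p) = (1 + p.2 ^+ 2)^-1 * cauchy_weight p.1.
Proof.
rewrite /cauchy_weight big_ord_recl tnth_cons_pair0; congr (_ * _).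
by apply: eq_bigr => i _; rewrite !(tnth_nth 0).
Qed.

Lemma integral_cauchy_weight (m : nat) :
  (\int[lebesgue_tuple R m]_x (cauchy_weight x)%:E = (pi ^+ m)%:E)%E.
Proof.
elim: m => [|m IHm].
  rewrite integral_dirac//.
    by rewrite diracT mul1e /cauchy_weight big_ord0.
  by apply/measurable_EFinP; exact: measurable_cauchy_weight.
have mE n : measurable_fun setT (EFin \o @cauchy_weight n).
  by apply/measurable_EFinP; exact: measurable_cauchy_weight.
rewrite ge0_integral_lebesgue_tupleS//; last first.
  by move=> x; rewrite lee_fin cauchy_weight_ge0.
transitivity (\int[lebesgue_tuple R m]_x ((cauchy_weight x)%:E * pi%:E))%E.
  apply: eq_integral => x _; rewrite -integral_oneDsqrV muleC -ge0_integralZr//.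
  - by apply: eq_integral => t _; rewrite cauchy_weight_cons_pair -EFinM.
  - by apply/measurable_EFinP; exact: measurable_oneDsqrV.
  - by move=> t _; rewrite lee_fin invr_ge0 ltW// oneDsqr_gt0.
  - by rewrite lee_fin cauchy_weight_ge0.
rewrite ge0_integralZr//; last 3 first.
- exact: mE.
- by move=> x _; rewrite lee_fin cauchy_weight_ge0.
- by rewrite lee_fin pi_ge0.
by rewrite IHm -EFinM exprSr.
Qed.

(** Each of the [m] factors [1 + tnth x i ^+ 2] is at most [1 + dot x x]. Radial decay of order [m]
    in [1 + dot x x] therefore suffices for integrability on R^m. *)
Lemma le_cauchy_weight (m : nat) (x : Rn R m) :
  (1 + dot x x) ^- m <= cauchy_weight x.
Proof.
rewrite -exprVn -[X in _ ^+ X](card_ord m) -prodr_const.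
apply: ler_prod => i _; rewrite invr_ge0 addr_ge0 ?dot_ge0//=.
rewrite lef_pV2 ?posrE ?oneDsqr_gt0 ?ltr_pwDl ?dot_ge0// lerD2l.
rewrite /dot (bigD1 i)//= expr2 lerDl; apply: sumr_ge0 => j _.
by rewrite -expr2 sqr_ge0.
Qed.

Lemma integrable_le_cauchy_weight (m : nat) (C : R) (F : Rn R m -> R) :
  measurable_fun setT F -> (forall x, `|F x| <= C * cauchy_weight x) ->
  (lebesgue_tuple R m).-integrable setT (EFin \o F).
Proof.
move=> mF FC; have iw : (lebesgue_tuple R m).-integrable setT (EFin \o @cauchy_weight m).
  apply/integrableP; split.
    by apply/measurable_EFinP; exact: measurable_cauchy_weight.
  under eq_integral do rewrite /= ger0_norm ?cauchy_weight_ge0//.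
  by rewrite integral_cauchy_weight ltry.
apply: le_integrable_EFin (integrableZl measurableT C iw) => //.
by move=> x; exact: le_trans (FC x) (ler_norm _).
Qed.

End cauchy_weight.

Section schwartz_functions.
Context {R : realType}.

Lemma oneD_exp_le (N : nat) (u : R) : 0 <= u -> (1 + u) ^+ N <= 2 ^+ N * (1 + u ^+ N).
Proof.
move=> u0; have uN0 : 0 <= u ^+ N by exact: exprn_ge0.
have [u1|u1] := leP u 1.
  apply: (@le_trans _ _ (2 ^+ N)).
    by rewrite lerXn2r ?nnegrE//; lra.
  by rewrite ler_peMr ?exprn_ge0//; lra.
apply: (@le_trans _ _ ((2 * u) ^+ N)).
  by rewrite lerXn2r ?nnegrE//; lra.
by rewrite exprMn ler_wpM2l ?exprn_ge0//; lra.
Qed.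

Lemma schwartz_bound (h : R -> R) (N p j : nat) : real_schwartz h ->
  exists C, forall x, `|x ^+ p * derive1n j h x| * (1 + x ^+ 2) ^+ N <= C.
Proof.
(* The exponents [p] and [2 * N + p] are the two terms of [(1 + x ^+ 2) ^+ N <= 2 ^+ N * (1 + x ^+
   (2 * N))]. *)
move=> [_ bh]; have [C1 hC1] := bh p j; have [C2 hC2] := bh (2 * N + p)%N j.
exists (2 ^+ N * (C1 + C2)) => x.
apply: (le_trans (ler_wpM2l (normr_ge0 _) (oneD_exp_le N (sqr_ge0 x)))).
rewrite mulrCA ler_wpM2l ?exprn_ge0// mulrDr mulr1 lerD//.
apply: le_trans (hC2 x); rewrite exprD exprM -[in leRHS]mulrA [leRHS]normrM mulrC.
by rewrite (ger0_norm (exprn_ge0 N (sqr_ge0 x))).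
Qed.

(** The product-rule form of [euler_op] for real functions. It is continuous at 0 as well, where
    [euler_op] follows the convention for [0^-1]. *)
Definition euler_fun (n : nat) (h : R -> R) (s : R) : R :=
  n%:R * h s + s * derive1 h s.

Lemma schwartz_is_derive (h : R -> R) (x : R) : real_schwartz h ->
  is_derive x 1 h (derive1 h x).
Proof. by move=> [dh _]; rewrite derive1E; apply: derivableP; exact: (dh 0). Qed.

Lemma schwartz_continuous (h : R -> R) : real_schwartz h -> continuous h.
Proof.
by move=> [dh _] x; apply/differentiable_continuous/derivable1_diffP; exact: (dh 0).
Qed.

Lemma continuous_derive1_schwartz (h : R -> R) : real_schwartz h ->
  continuous (derive1 h : R -> R).
Proof.
by move=> [dh _] x; apply/differentiable_continuous/derivable1_diffP; exact: (dh 1).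
Qed.

Lemma continuous_euler_fun (n : nat) (h : R -> R) : real_schwartz h ->
  continuous (euler_fun n h).
Proof.
move=> sh x; apply: cvgD.
  by apply: cvgM; [exact: cvg_cst|exact: schwartz_continuous].
by apply: cvgM; [exact: cvg_id|exact: continuous_derive1_schwartz].
Qed.

Lemma euler_fun_bound (n N : nat) (h : R -> R) : real_schwartz h ->
  exists C, forall x, `|euler_fun n h x| * (1 + x ^+ 2) ^+ N <= C.
Proof.
move=> sh; have [C1 hC1] := schwartz_bound N 0 0 sh.
have [C2 hC2] := schwartz_bound N 1 1 sh.
exists (n%:R * C1 + C2) => x.
have h1 := hC1 x; have h2 := hC2 x; rewrite expr0 mul1r /= in h1; rewrite expr1 /= in h2.
have w0 : 0 <= (1 + x ^+ 2) ^+ N by rewrite exprn_ge0// addr_ge0// sqr_ge0.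
apply: (le_trans (ler_wpM2r w0 (ler_normD _ _))).
by rewrite mulrDl lerD// normrM normr_nat -mulrA ler_wpM2l//.
Qed.

(** For [|u| < 1] and [v = expR u * s], one has [1 + s ^+ 2 <= expR 1 ^+ 2 * (1 + v ^+ 2)], so decay
    in the dilated variable is decay in [s = enorm x], uniformly in [u]. The remaining power of
    [expR 1] bounds [expR u ^+ m]. *)
Lemma dilated_bound (m : nat) (g : R -> R) (C u : R) (x : Rn R m) :
  (forall v, `|g v| * (1 + v ^+ 2) ^+ m <= C) -> u \in `](-1), 1[ ->
  `|expR u ^+ m * g (expR u * enorm x)| <=
    expR 1 ^+ m * (C * (expR 1 ^+ 2) ^+ m) * cauchy_weight x.
Proof.
rewrite in_itv/= => gC /andP[u1 u2].
set s := enorm x; set v := expR u * s.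
have s2 : s ^+ 2 = dot x x := sqr_enorm x.
have e1 : 1 <= expR 1 :> R by rewrite -{1}expR0 ler_expR.
have v0 : 0 < (1 + v ^+ 2) ^+ m by rewrite exprn_gt0// oneDsqr_gt0.
have s0 : 0 < (1 + s ^+ 2) ^+ m by rewrite exprn_gt0// oneDsqr_gt0.
have C0 : 0 <= C by apply: le_trans (gC 0); rewrite mulr_ge0// exprn_ge0// addr_ge0// sqr_ge0.
rewrite normrM (ger0_norm (exprn_ge0 _ (expR_ge0 u))) -mulrA.
apply: ler_pM => //.
- by rewrite lerXn2r ?nnegrE ?expR_ge0// ler_expR ltW.
apply: le_trans (_ : C * (expR 1 ^+ 2) ^+ m * (1 + s ^+ 2) ^- m <= _); last first.
  by rewrite s2 ler_wpM2l ?le_cauchy_weight// mulr_ge0// exprn_ge0// exprn_ge0// expR_ge0.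
rewrite ler_pdivlMr// -(ler_pM2r v0) mulrAC.
apply: (@le_trans _ _ (C * (1 + s ^+ 2) ^+ m)); first by rewrite ler_wpM2r// ltW.
rewrite -mulrA ler_wpM2l// -exprMn; apply: lerXn2r; rewrite ?nnegrE.
- by rewrite ltW// oneDsqr_gt0.
- by rewrite ltW// mulr_gt0 ?oneDsqr_gt0// exprn_gt0// expR_gt0.
have -> : s = expR (- u) * v by rewrite /v mulrA -expRD addNr expR0 mul1r.
have : expR (- u) ^+ 2 <= expR 1 ^+ 2.
  by rewrite lerXn2r ?nnegrE ?expR_ge0// ler_expR lerNl ltW.
have : 1 <= expR 1 ^+ 2 :> R by rewrite exprn_ege1.
by move=> a1 a2; rewrite exprMn mulrDr mulr1 lerD// ler_wpM2r// sqr_ge0.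
Qed.

End schwartz_functions.

(** * The Euler operator and the second formula *)

Section euler.
Context {R : realType}.

Lemma measurable_comp_sqrt (h : R -> R) : continuous h ->
  measurable_fun setT (h \o Num.sqrt).
Proof.
move=> ch; apply: measurableT_comp; first exact: continuous_measurable_fun.
by apply: continuous_measurable_fun; exact: sqrt_continuous.
Qed.

Lemma enorm_dilate (m : nat) (a : R) (x : Rn R m) : 0 <= a ->
  enorm (dilate a x) = a * enorm x.
Proof. by move=> a0; rewrite /enorm dot_dilate sqrtrM ?sqr_ge0// sqrtr_sqr ger0_norm. Qed.

Lemma measurable_radial (m : nat) (h : R -> R) (a : R) : continuous h ->
  measurable_fun setT (fun x : Rn R m => h (a * enorm x)).
Proof.
move=> ch; apply: (measurable_comp_dot (k := fun q => h (a * Num.sqrt q))).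
apply: continuous_measurable_fun => q; apply: continuous_comp; last exact: ch.
by apply: cvgM; [exact: cvg_cst|exact: sqrt_continuous].
Qed.

Lemma integrable_dilated (m : nat) (h : R -> R) (C u w : R) :
  continuous h -> (forall v, `|h v| * (1 + v ^+ 2) ^+ m.+1 <= C) ->
  u \in `](-1), 1[ ->
  (lebesgue_tuple R m.+1).-integrable setT (EFin \o (fun x =>
    expR u ^+ m.+1 * h (expR u * enorm x) * cos (w * tnth x ord0))).
Proof.
move=> ch hC uI; apply: integrable_mul_bounded.
- exact: measurable_cos_coord0.
- by move=> x; exact: cos_max.
apply: integrable_le_cauchy_weight => [|x]; last exact: dilated_bound hC uI.
by apply: measurable_funM => //; exact: measurable_radial.
Qed.

Lemma integrable_radial (m : nat) (h : R -> R) (C : R) : continuous h ->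
  (forall v, `|h v| * (1 + v ^+ 2) ^+ m <= C) ->
  (lebesgue_tuple R m).-integrable setT (EFin \o (fun x => (h \o Num.sqrt) (dot x x))).
Proof.
move=> ch hC; apply: (@integrable_le_cauchy_weight R m C) => [|x].
  by apply: measurable_comp_dot; exact: measurable_comp_sqrt.
have h1 := hC (enorm x); rewrite sqr_enorm in h1.
have d0 : 0 < (1 + dot x x) ^+ m by rewrite exprn_gt0// ltr_pwDl// dot_ge0.
have C0 : 0 <= C by apply: le_trans h1; rewrite mulr_ge0// ltW.
apply: le_trans (ler_wpM2l C0 (le_cauchy_weight x)).
by rewrite ler_pdivlMr.
Qed.

Lemma integrable_schwartz (m : nat) (h : R -> R) : real_schwartz h ->
  (lebesgue_tuple R m).-integrable setT (EFin \o (fun x => (h \o Num.sqrt) (dot x x))).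
Proof.
move=> sh; have [C hC] := schwartz_bound m 0 0 sh.
apply: (@integrable_radial m h C); first exact: schwartz_continuous.
by move=> v; have := hC v; rewrite expr0 mul1r.
Qed.

Lemma integrable_euler_fun (n m : nat) (h : R -> R) : real_schwartz h ->
  (lebesgue_tuple R m).-integrable setT
    (EFin \o (fun x => (euler_fun n h \o Num.sqrt) (dot x x))).
Proof.
move=> sh; have [C hC] := euler_fun_bound n m sh.
by apply: integrable_radial hC; exact: continuous_euler_fun.
Qed.

Lemma cos_transform_dilate (m : nat) (h : R -> R) (r u : R) : continuous h ->
  \int[lebesgue_tuple R m.+1]_x
    (expR u ^+ m.+1 * h (expR u * enorm x) * cos (2 * pi * r * tnth x ord0)) =
  cos_transform m (h \o Num.sqrt) (r * expR (- u)).
Proof.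
move=> ch; have u0 : expR u != 0 by rewrite gt_eqF// expR_gt0.
rewrite /cos_transform -[RHS](Rintegral_dilate u0); last first.
  apply: (measurable_radial_mul (k := h \o Num.sqrt)
    (g := fun t => cos (2 * pi * (r * expR (- u)) * t))).
    exact: measurable_comp_sqrt.
  apply: continuous_measurable_fun => t.
  by apply: continuous_comp; [exact: mulrl_continuous|exact: continuous_cos].
apply: eq_Rintegral => x _; rewrite ger0_norm ?expR_ge0// tnth_mktuple.
rewrite -[(h \o _) _]/(h (enorm (dilate (expR u) x))) enorm_dilate ?expR_ge0//.
rewrite (_ : 2 * pi * (r * expR (- u)) * (expR u * tnth x ord0) =
  2 * pi * r * tnth x ord0); first by ring.
by rewrite expRN; field.
Qed.

(** The derivative has the form of the original with [euler_fun n h] in place of [h], so a single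
    decay estimate for [euler_fun n h] dominates it for all [u] in []-1, 1[]. *)
Lemma is_derive_dilated (n : nat) (h : R -> R) (s c u : R) : real_schwartz h ->
  is_derive u 1 (fun u => expR u ^+ n * h (expR u * s) * c)
    (expR u ^+ n * euler_fun n h (expR u * s) * c).
Proof.
move=> sh.
have dg : is_derive u 1 (fun u => expR u * s) (expR u * s).
  by apply: is_derive_eq; rewrite /GRing.scale/=; ring.
have dh := schwartz_is_derive (expR u * s) sh.
have dhg : is_derive u 1 (fun u => h (expR u * s)) _ :=
  @is_derive1_comp R h (fun u => expR u * s) u _ _ dh dg.
have dp : is_derive u 1 (fun u => expR u ^+ n) (n%:R * expR u ^+ n).
  have -> : (fun u : R => expR u ^+ n) = (expR : R -> R) ^+ n by rewrite exprfctE.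
  apply: is_derive_eq; rewrite /GRing.scale/=.
  by case: (n) => [|k]; rewrite ?mul0r// -mulrA -exprSr.
by apply: is_derive_eq; rewrite /GRing.scale/= /euler_fun; ring.
Qed.

Lemma cos_transform_euler (m : nat) (h : R -> R) (r : R) : real_schwartz h -> r != 0 ->
  cos_transform m (euler_fun m.+1 h \o Num.sqrt) r =
  - r * derive1 (cos_transform m (h \o Num.sqrt)) r.
Proof.
move=> sh r0; have ch := schwartz_continuous sh.
have mk : measurable_fun setT (h \o Num.sqrt) := measurable_comp_sqrt ch.
have [dT _] := cos_transform_dimension_shift mk r0
  (integrable_schwartz m.+3 sh) (integrable_schwartz m.+1 sh).
have [C hC] := schwartz_bound m.+1 0 0 sh.
have {}hC v : `|h v| * (1 + v ^+ 2) ^+ m.+1 <= C.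
  by have := hC v; rewrite expr0 mul1r.
have [D hD] := euler_fun_bound m.+1 m.+1 sh.
pose f (u : R) (x : Rn R m.+1) :=
  expR u ^+ m.+1 * h (expR u * enorm x) * cos (2 * pi * r * tnth x ord0).
pose f' (u : R) (x : Rn R m.+1) :=
  expR u ^+ m.+1 * euler_fun m.+1 h (expR u * enorm x) * cos (2 * pi * r * tnth x ord0).
have df (u : R) x : is_derive u 1 (f ^~ x) (f' u x).
  exact: is_derive_dilated.
have d1f u x : partial1of2 f u x = f' u x.
  by rewrite partial1of2E; exact: derive_val.
pose c := expR 1 ^+ m.+1 * (D * (expR 1 ^+ 2) ^+ m.+1).
pose G (x : Rn R m.+1) := `|c * cauchy_weight x|.
have G0 : forall x, 0 <= G x by move=> x; exact: normr_ge0.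
have intG : (lebesgue_tuple R m.+1).-integrable setT (EFin \o G).
  apply: (@integrable_le_cauchy_weight R m.+1 `|c|).
    apply: measurableT_comp; first exact: normr_measurable.
    by apply: measurable_funM => //; exact: measurable_cauchy_weight.
  by move=> x; rewrite /G normr_id normrM (ger0_norm (cauchy_weight_ge0 x)).
have I0 : (`](-1), 1[%classic : set R) 0 by rewrite /= in_itv/= ltrN10 ltr01.
have intf u : (`](-1), 1[%classic : set R) u ->
    (lebesgue_tuple R m.+1).-integrable setT (EFin \o f u).
  by move=> uI; exact: integrable_dilated hC uI.
have derf u x : (`](-1), 1[%classic : set R) u -> setT x ->
    derivable (f ^~ x) u 1 by move=> _ _; exact: ex_derive.
have Gub u x : (`](-1), 1[%classic : set R) u -> setT x ->
    `|partial1of2 f u x| <= G x.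
  move=> uI _; rewrite d1f /f' normrM.
  apply: (@le_trans _ _ `|expR u ^+ m.+1 * euler_fun m.+1 h (expR u * enorm x)|).
    by rewrite ler_piMr// cos_max.
  exact: le_trans (@dilated_bound R _ _ _ _ x hD uI) (ler_norm _).
have dv := differentiation_under_integral measurableT I0 intf derf G0 intG Gub.
have fE : (fun u => \int[lebesgue_tuple R m.+1]_x f u x) =
    cos_transform m (h \o Num.sqrt) \o (fun u => r * expR (- u)).
  by apply/funext => u; exact: cos_transform_dilate.
(* The chain rule through [r * expR (- u)], whose derivative at 0 is [- r], gives a second
   expression for the derivative computed under the integral sign. *)
rewrite fE derive1_comp in dv; last 2 first.
- exact: ex_derive.
- by rewrite oppr0 expR0 mulr1.
have der : is_derive (0 : R) 1 (fun u => r * expR (- u)) (- r).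
  by apply: is_derive_eq; rewrite /GRing.scale/= oppr0 expR0; ring.
rewrite [X in _ * X]derive1E derive_val oppr0 expR0 mulr1 mulrC in dv.
rewrite dv; apply: eq_Rintegral => x _; rewrite d1f /f' expR0 expr1n !mul1r.
by [].
Qed.

End euler.

Local Open Scope complex_scope.

Section euler_complex.
Context {R : realType}.

Lemma L1_radial_schwartz (m : nat) (phi : R -> R[i]) : schwartz phi ->
  L1 m (radial phi).
Proof.
move=> [sR sI]; exists (radial phi); split; last exact: aeW.
- exact: (integrable_schwartz m sR).
- exact: (integrable_schwartz m sI).
Qed.

Lemma derive1_mulX (n : nat) (h : R -> R) (s : R) : real_schwartz h -> s != 0 ->
  s ^- n * derive1 (fun t => h t * t ^+ n.+1) s = euler_fun n.+1 h s.
Proof.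
move=> sh s0; have dh := schwartz_is_derive s sh.
have dp : is_derive s 1 (fun t : R => t ^+ n.+1) (n.+1%:R * s ^+ n).
  have -> : (fun t : R => t ^+ n.+1) = (id : R -> R) ^+ n.+1 by rewrite exprfctE.
  by apply: is_derive_eq; rewrite /GRing.scale/= mulr1.
have dhp : is_derive s 1 (fun t => h t * t ^+ n.+1)
    (h s * (n.+1%:R * s ^+ n) + s ^+ n.+1 * derive1 h s) by exact: is_deriveM.
rewrite derive1E derive_val /euler_fun exprS.
by field; rewrite expf_neq0.
Qed.

Lemma euler_op_parts (n : nat) (phi : R -> R[i]) (s : R) : schwartz phi -> s != 0 ->
  euler_op n.+1 phi s =
  euler_fun n.+1 (@complex.Re R \o phi) s +i* euler_fun n.+1 (@complex.Im R \o phi) s.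
Proof.
move=> [sR sI] s0; rewrite -!derive1_mulX// /euler_op /Cderive.
have -> : @complex.Re R \o (fun t => phi t * (t ^+ n.+1)%:C) =
    fun t => (@complex.Re R \o phi) t * t ^+ n.+1.
  by apply/funext => t /=; case: (phi t) => a b /=; ring.
have -> : @complex.Im R \o (fun t => phi t * (t ^+ n.+1)%:C) =
    fun t => (@complex.Im R \o phi) t * t ^+ n.+1.
  by apply/funext => t /=; case: (phi t) => a b /=; ring.
by simpc.
Qed.

Lemma radial_fourier_schwartz (m : nat) (phi : R -> R[i]) (r : R) : schwartz phi ->
  radial_fourier m.+1 phi r =
  cos_transform m ((@complex.Re R \o phi) \o Num.sqrt) r +i*
  cos_transform m ((@complex.Im R \o phi) \o Num.sqrt) r.
Proof.
move=> [sR sI]; apply: radial_fourierE.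
- by apply: measurable_comp_sqrt; exact: schwartz_continuous.
- by apply: measurable_comp_sqrt; exact: schwartz_continuous.
- exact: integrable_schwartz.
- exact: integrable_schwartz.
- exact: aeW.
- exact: aeW.
Qed.

Lemma radial_fourier_euler (m : nat) (phi : R -> R[i]) (r : R) : schwartz phi ->
  r != 0 ->
  radial_fourier m.+1 (euler_op m.+1 phi) r =
  (- r)%:C * Cderive (radial_fourier m.+1 phi) r.
Proof.
move=> sphi r0; have [sR sI] := sphi.
have -> : radial_fourier m.+1 phi = fun s =>
    cos_transform m ((@complex.Re R \o phi) \o Num.sqrt) s +i*
    cos_transform m ((@complex.Im R \o phi) \o Num.sqrt) s.
  by apply/funext => s; exact: radial_fourier_schwartz.
rewrite /Cderive.
rewrite -[@complex.Re R \o (fun=> _)]/(cos_transform m ((@complex.Re R \o phi) \o Num.sqrt)).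
rewrite -[@complex.Im R \o (fun=> _)]/(cos_transform m ((@complex.Im R \o phi) \o Num.sqrt)).
transitivity (cos_transform m (euler_fun m.+1 (@complex.Re R \o phi) \o Num.sqrt) r +i*
  cos_transform m (euler_fun m.+1 (@complex.Im R \o phi) \o Num.sqrt) r); last first.
  by rewrite !cos_transform_euler//; simpc.
apply: radial_fourierE.
- by apply: measurable_comp_sqrt; exact: continuous_euler_fun.
- by apply: measurable_comp_sqrt; exact: continuous_euler_fun.
- exact: integrable_euler_fun.
- exact: integrable_euler_fun.
(* Only [0 < q] is compared, so [euler_op] is evaluated away from 0, where it agrees with
   [euler_fun]. *)
- apply: (ae_radial m (h := @complex.Re R \o euler_op m.+1 phi)).
  by apply: aeW => q q0; rewrite [LHS]/comp euler_op_parts// gt_eqF// sqrtr_gt0.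
- apply: (ae_radial m (h := @complex.Im R \o euler_op m.+1 phi)).
  by apply: aeW => q q0; rewrite [LHS]/comp euler_op_parts// gt_eqF// sqrtr_gt0.
Qed.

End euler_complex.

Theorem theorem1p1 (R : realType) (n : nat) (hn : (1 <= n)%N) :
  (forall f : R -> R[i],
     L1 n.+2 (radial f) -> L1 n (radial f) ->
     forall r : R, 0 < r ->
       Cderivable (radial_fourier n f) r /\
       radial_fourier n.+2 f r =
         - ((2 * pi)^-1)%:C * (r^-1)%:C * Cderive (radial_fourier n f) r) /\
  (forall phi : R -> R[i],
     schwartz phi -> (forall x : R, phi (- x) = phi x) ->
     forall r : R, 0 < r ->
       radial_fourier n.+2 phi r =
         ((2 * pi)^-1)%:C * ((r ^+ 2)^-1)%:C *
         radial_fourier n (euler_op n phi) r).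
Proof.
case: n hn => // m _; split=> [f f3 f1 r r0|phi sphi _ r r0].
  exact: radial_fourier_dimension_shift.
have [_ ->] := radial_fourier_dimension_shift (L1_radial_schwartz m.+3 sphi)
  (L1_radial_schwartz m.+1 sphi) r0.
(* The transform of [euler_op] is [- r] times the derivative appearing in the first formula, which
   turns the factor [- 1 / (2 pi r)] into [1 / (2 pi r^2)]. *)
rewrite radial_fourier_euler ?lt0r_neq0// mulrA; congr (_ * _).
have p0 : (pi : R) != 0 by rewrite gt_eqF// pi_gt0.
have rn0 : r != 0 by rewrite gt_eqF.
move: p0; generalize (pi : R) => p p0.
by simpc; congr (_ +i* _); field; rewrite p0 rn0.
Qed.
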